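(* Given integers $k,t$ with $t-1>k\ge 4$ and a constant $\gamma>0$, there exists an integer $n_0=n_0(k,t,\gamma)$ such that, for all $n\ge n_0$ with $t\mid n$, the following statements hold: (i) If $5\le k+1<t<3k/2-1$, then $$t^k(n,t)\le\left(1-2\binom{t}{k-1}^{-1}+\gamma\right)n.$$ (ii) If $k\ge 6$ and $2t\ge 3(k-1)+\sqrt{5k^2-22k+25}$, then $$t^k(n,t)\le\left(1-\binom{t-1}{k-1}^{-1}+\gamma\right)n.$$
   Context: A $k$-graph $H$ is a pair $(V(H),E(H))$ with $V(H)$ finite and $E(H)\subseteq\binom{V(H)}{k}$; its order is $|V(H)|$. For a $(k-1)$-set $T\subseteq V(H)$, $\deg(T)$ is the number of vertices $v$ such that $T\cup\{v\}$ is an edge, and $\delta_{k-1}(H)$ is the minimum of $\deg(T)$ over all $(k-1)$-sets $T$. $K_t^k$ is the complete $k$-graph on $t$ vertices. An $F$-factor in $H$ is a spanning subgraph consisting of vertex-disjoint copies of $F$. For $t\mid n$, $t^k(n,t)$ is the smallest integer $d$ such that every $k$-graph $H$ of order $n$ with $\delta_{k-1}(H)\ge d$ contains a $K_t^k$-factor. *)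

(* Defs.v *)
From HB Require Import structures.
From mathcomp Require Import all_boot all_order all_algebra.
From mathcomp Require Import boolp reals.

Set Implicit Arguments.
Unset Strict Implicit.
Unset Printing Implicit Defensive.

Record kgraph (k : nat) := KGraph {
  vertex :> finType;
  edges : {set {set vertex}};
  edges_card : {in edges, forall e : {set vertex}, #|e| = k}
}.

Definition order k (H : kgraph k) : nat := #|H|.

Definition deg k (H : kgraph k) (T : {set H}) : nat :=
  #|[set v : H | v |: T \in edges H]|.

(* Always deg T <= order H, so starting the minimum at order H changes nothing
   as soon as H has a (k-1)-set of vertices. *)
Definition min_codeg k (H : kgraph k) : nat :=
  \big[minn/order H]_(T : {set H} | #|T| == k.-1) deg T.

Lemma complete_edges_card k t :
  {in [set e : {set 'I_t} | #|e| == k], forall e : {set 'I_t}, #|e| = k}.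
Proof. by move=> e; rewrite inE => /eqP. Qed.

Definition complete k t : kgraph k := KGraph (@complete_edges_card k t).

Definition embedding k (F H : kgraph k) (f : F -> H) : Prop :=
  injective f /\ {in edges F, forall e : {set F}, f @: e \in edges H}.

(* The blocks of P are the vertex sets of the disjoint copies of F. *)
Definition has_factor k (F H : kgraph k) : Prop :=
  exists2 P : {set {set H}}, partition P [set: H] &
    {in P, forall A : {set H},
      exists2 f : F -> H, embedding f & f @: [set: F] = A}.

Definition forces_factor k n t (d : nat) : Prop :=
  forall H : kgraph k,
    order H = n -> d <= min_codeg H -> has_factor (complete k t) H.

Lemma min_codeg_le_order k (H : kgraph k) : min_codeg H <= order H.
Proof.
rewrite /min_codeg; elim/big_rec: _ => // T m _ le_m.
by rewrite geq_min le_m orbT.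
Qed.

Lemma forces_factor_ex k n t : exists d, `[< forces_factor k n t d >].
Proof.
exists n.+1; apply/asboolP => H <- lt_H.
by have := leq_trans lt_H (min_codeg_le_order H); rewrite ltnn.
Qed.

(* Ranging over natural numbers d loses nothing: when 0 < n and k <= t, the
   edgeless k-graph shows that no d <= 0 forces a factor. *)
Definition factor_threshold k n t : nat := ex_minn (forces_factor_ex k n t).

(* Main.v *)
Require Import Defs.
From mathcomp Require Import all_boot all_order all_algebra.
From mathcomp Require Import boolp reals sequences exp.
From mathcomp Require Import zify ring lra.

Set Implicit Arguments.
Unset Strict Implicit.
Unset Printing Implicit Defensive.
Import Order.TTheory GRing.Theory Num.Theory.

(** Put [x = k - 1] and let [alpha] be [2 / C(t, x)] in part (i) and
[1 / C(t - 1, x)] in part (ii).  A minimum codegree of [(1 - alpha + gamma) n]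
says that every [x]-set [S] has at most [a n] non-neighbours, where
[a < alpha]; in a large [k]-graph this forces a tiling of all vertices by
cliques of order [t] ([small_nonnbr_factor]).  The proof is by absorption.

Almost perfect tilings ([almost_tiling]).  By linear programming duality, a
perfect fractional tiling exists as soon as, for every cost function on the
vertices, some [t]-clique costs no more than [t] times the average vertex.
Such a clique is found greedily: with the vertices sorted by cost, a clique of
order [j] can be extended by one of the first [C(j, x) a n + j + 1] of them
([light_clique_greedy]).  In part (ii) this fails for the last vertex only, and
a clique [Q] of order [t - 1] is then completed by an exchange: most vertices
are blocked by exactly one [x]-subset of [Q], and two such vertices replace one
vertex that lies in both blocking sets ([light_clique_exchange]).  A fractional
tiling is not used as such.  Cliques are removed one at a time, and the cost is
chosen so that an exponential potential of the relative non-degrees of all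
[x]-sets hardly grows; thus the remaining vertices keep satisfying the
condition until few of them are left.

Connections ([connected]).  Vertices [u] and [v] are exchangeable by a set that
forms tileable sets with either of them.  Each vertex is exchangeable with a
positive proportion of the others by a clique of order [t - 1]
([linked_degree]), and across every cut into two large parts a positive
proportion of the pairs is exchangeable ([linked_cut]).  For the latter, let
[T] be a clique of order [t] that meets both parts.  On average a vertex is
blocked by fewer than [2] of the [x]-subsets of [T]; a vertex that is blocked
by no subset, or only by one that meets both parts, replaces a vertex of [T]
on the other side of the cut ([many_crossing]).  It remains to choose [T] with
few [x]-subsets inside a part.  In part (i) there are none; in part (ii) three
vertices are taken from each part, and the quadratic inequality between [k] and
[t] is exactly [C(t, x) + C(t - 3, x) <= 2 C(t - 1, x)].  Consequently the set
of vertices that are connected to a given one grows by a fixed proportion until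
it contains almost all vertices.

Absorption ([absorbing]).  A clique [y_1 .. y_t] together with connections
between [x_i] and [y_i] absorbs the set [x_1 .. x_t].  Since absorbers of each
[t]-set make up a positive proportion of all sequences, a small disjoint family
with linearly many absorbers of each [t]-set is obtained by another potential
argument; it takes in the vertices missed by an almost perfect tiling. *)


(** * Cliques and non-neighbourhoods *)

Section Cliques.
Variables (k : nat) (H : kgraph k).
Hypothesis k_gt0 : 0 < k.
Implicit Types (S Q e A B : {set H}) (v : H).

Definition clique Q : bool :=
  [forall e : {set H}, (e \subset Q) && (#|e| == k) ==> (e \in edges H)].

Definition nonnbr S : {set H} := [set v | (v \notin S) && (v |: S \notin edges H)].

Lemma cliqueP Q :
  reflect (forall e, e \subset Q -> #|e| = k -> e \in edges H) (clique Q).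
Proof.
apply: (iffP forallP) => [h e eQ ek|h e]; last first.
  by apply/implyP => /andP[eQ /eqP]; exact: h.
by have /implyP := h e; rewrite eQ ek eqxx; apply.
Qed.

Lemma clique_sub Q Q' : Q \subset Q' -> clique Q' -> clique Q.
Proof.
move=> QQ' /cliqueP h; apply/cliqueP => e eQ; apply: h.
exact: subset_trans QQ'.
Qed.

Lemma clique_setU1 v Q :
    clique Q -> (forall S, S \subset Q -> #|S| = k.-1 -> v \notin nonnbr S) ->
  clique (v |: Q).
Proof.
move=> /cliqueP cQ h; apply/cliqueP => e eQ ek.
have [ve|ve] := boolP (v \in e); last first.
  apply: cQ => //; apply/subsetP => y ye; have := subsetP eQ _ ye.
  by rewrite !inE; case/predU1P => // yv; rewrite -yv ye in ve.
have eS : e :\ v \subset Q by rewrite subDset.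
have /(h _ eS) : #|e :\ v| = k.-1 by have := cardsD1 v e; rewrite ve ek; lia.
by rewrite !inE eqxx /= setD1K // negbK.
Qed.

Lemma clique_small Q : #|Q| < k -> clique Q.
Proof.
clear k_gt0; move=> Qk; apply/cliqueP => e /subset_leq_card eQ ek; lia.
Qed.

Definition tileable t A : Prop :=
  exists2 P, partition P A & {in P, forall B, clique B /\ #|B| = t}.

Lemma tileable0 t : tileable t set0.
Proof.
exists set0 => [|B]; last by rewrite inE.
by apply/and3P; split; rewrite ?inE // ?/cover ?big_set0 //; apply/trivIsetP => A B; rewrite inE.
Qed.

Lemma tileable_clique t A : 0 < t -> clique A -> #|A| = t -> tileable t A.
Proof.
move=> t_gt0 cA At; exists [set A] => [|B /set1P -> //].
apply/and3P; split; rewrite ?/cover ?big_set1 //.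
  by apply/trivIsetP => B C /set1P-> /set1P->; rewrite eqxx.
by rewrite inE eq_sym -card_gt0 At.
Qed.

Lemma tileableU t A B : [disjoint A & B] -> tileable t A -> tileable t B -> tileable t (A :|: B).
Proof.
move=> dAB [P /and3P[/eqP cP tP P0] hP] [P' /and3P[/eqP cP' tP' P'0] hP'].
exists (P :|: P'); last by move=> C; rewrite inE => /orP[/hP|/hP'].
apply/and3P; split.
- by rewrite /cover bigcup_setU -/(cover P) -/(cover P') cP cP'.
- have sub C : C \in P -> C \subset A by move=> CP; rewrite -cP bigcup_sup.
  have sub' C : C \in P' -> C \subset B by move=> CP; rewrite -cP' bigcup_sup.
  apply/trivIsetP => C D; rewrite !inE => /orP[CP|CP] /orP[DP|DP] CD.
  + exact: (trivIsetP tP).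
  + exact: disjointWl (sub _ CP) (disjointWr (sub' _ DP) dAB).
  + rewrite disjoint_sym.
    exact: disjointWl (sub _ DP) (disjointWr (sub' _ CP) dAB).
  + exact: (trivIsetP tP').
- by rewrite inE negb_or P0.
Qed.

Lemma tileable_dvd t A : tileable t A -> t %| #|A|.
Proof.
move=> [P PA hP]; rewrite (card_partition PA).
by apply: dvdn_sum => B /hP[_ ->].
Qed.

End Cliques.

Lemma card_sum_mem (I : finType) (A : {set I}) : #|A| = \sum_i (i \in A).
Proof.
by rewrite -sum1_card big_mkcond; apply: eq_bigr => i _; case: (i \in A).
Qed.

Lemma leq_card_bigcup (I T : finType) (P : pred I) (F : I -> {set T}) :
  #|\bigcup_(i | P i) F i| <= \sum_(i | P i) #|F i|.
Proof.
elim/big_rec2: _ => [|i A m _ IH]; first by rewrite cards0.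
apply: leq_trans (leq_card_setU _ _) _; by rewrite leq_add2l.
Qed.

(** * Robust properties of sequences *)

Section Robust.
Variable V : finType.
Implicit Types (P Q : pred (seq V)) (s : seq V) (F : {set V}) (m h : nat).

(** A form of positive density, with [m] a small proportion of [#|V|], that is
preserved when sequences are concatenated or have to avoid a bounded number of
vertices, at the cost of a bounded decrease of [m]. *)
Fixpoint robust m h P : bool :=
  if h is h'.+1 then m <= #|[set v | robust m h' (fun s => P (v :: s))]|
  else P [::].

Fixpoint count_seq h P : nat :=
  if h is h'.+1 then \sum_(v : V) count_seq h' (fun s => P (v :: s))
  else P [::].

Lemma robust_impl m m' h P Q : m' <= m ->
    (forall s, size s = h -> P s -> Q s) -> robust m h P -> robust m' h Q.
Proof.
move=> mm'; elim: h P Q => [|h IH] P Q PQ /=; first exact: PQ.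
move=> hm; apply: (leq_trans mm'); apply: (leq_trans hm); apply: subset_leq_card.
apply/subsetP => v; rewrite !inE; apply: IH => s sh; apply: PQ; rewrite /= sh //.
Qed.

Lemma robust_ex m h P : 0 < m -> robust m h P -> exists2 s, size s = h & P s.
Proof.
move=> m_gt0; elim: h P => [|h IH] P /=; first by exists [::].
move=> /(leq_trans m_gt0)/card_gt0P[v]; rewrite inE => /IH[s sh Ps].
by exists (v :: s); rewrite //= sh.
Qed.

Lemma eq_robust m h P Q :
  (forall s, size s = h -> P s = Q s) -> robust m h P = robust m h Q.
Proof.
by move=> PQ; apply/idP/idP; apply: robust_impl => // s /PQ ->.
Qed.

Lemma robust_cat m h1 h2 P :
  robust m (h1 + h2) P = robust m h1 (fun s1 => robust m h2 (fun s2 => P (s1 ++ s2))).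
Proof.
elim: h1 P => //= h1 IH P; congr (_ <= _).
by apply: eq_card => v; rewrite !inE IH.
Qed.

Lemma robust_avoid m h P F : robust m h P ->
  robust (m - #|F|) h (fun s => P s && all [predC F] s).
Proof.
elim: h P => [|h IH] P /=; first by rewrite andbT.
move=> hm; set A := [set v | _] in hm.
apply: (@leq_trans #|A :\: F|).
  have := cardsD A F; have := subset_leq_card (subsetIr A F); lia.
apply: subset_leq_card; apply/subsetP => v; rewrite !inE => /andP[vF vA].
apply: robust_impl (IH _ vA) => // s _ /andP[-> ->]; by rewrite vF.
Qed.

Lemma count_seq_le h P : count_seq h P <= #|V| ^ h.
Proof.
elim: h P => [|h IH] P /=; first by case: (P _).
rewrite expnS -sum_nat_const; exact: leq_sum.
Qed.

Lemma eq_count_seq h P Q :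
  (forall s, size s = h -> P s = Q s) -> count_seq h P = count_seq h Q.
Proof.
elim: h P Q => [|h IH] P Q PQ /=; first by rewrite PQ.
by apply: eq_bigr => v _; apply: IH => s sh; apply: PQ; rewrite /= sh.
Qed.

Lemma leq_count_seq h P Q :
  (forall s, size s = h -> P s -> Q s) -> count_seq h P <= count_seq h Q.
Proof.
elim: h P Q => [|h IH] P Q PQ /=.
  by have := PQ [::] erefl; case: (P _) => // ->.
by apply: leq_sum => v _; apply: IH => s sh; apply: PQ; rewrite /= sh.
Qed.

Lemma count_seq_has (I : finType) h (P : I -> pred (seq V)) :
  count_seq h (fun s => [exists i, P i s]) <= \sum_i count_seq h (P i).
Proof.
elim: h P => [|h IH] P /=.
  case: existsP => [[i Pi]|//]; by rewrite (bigD1 i) //= Pi.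
by rewrite exchange_big; apply: leq_sum => v _; exact: IH.
Qed.

Lemma robust_count m h P : robust m h P -> m ^ h <= count_seq h P.
Proof.
elim: h P => [|h IH] P /=; first by case: (P _).
move=> hm; rewrite expnS.
apply: (leq_trans (leq_mul hm (leqnn _))); rewrite -sum_nat_const.
rewrite big_mkcond /=; apply: leq_sum => v _.
by case: ifPn => [|//]; rewrite inE; exact: IH.
Qed.

(** Fewer than [m] first entries have a robust continuation, and these account
for at most [m * #|V| ^ h] sequences; the other first entries contribute little
by induction.  Thus a property of a positive proportion of the sequences is
robust. *)
Lemma count_nonrobust m h P : ~~ robust m h P ->
  count_seq h P * #|V| <= h * m * #|V| ^ h.
Proof.
elim: h P => [|h IH] P /=; first by move=> /negbTE->.
rewrite -ltnNge => hm; set A := [set v | _] in hm.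
rewrite big_distrl /=.
have hA v : count_seq h (fun s => P (v :: s)) * #|V| <=
    (v \in A) * #|V| ^ h.+1 + h * m * #|V| ^ h.
  case: (boolP (v \in A)) => vA.
    by rewrite mul1n expnSr (leq_trans _ (leq_addr _ _)) // leq_mul // count_seq_le.
  by rewrite mul0n IH //; rewrite inE in vA.
apply: (@leq_trans (\sum_(v : V) ((v \in A) * #|V| ^ h.+1 + h * m * #|V| ^ h))).
  by apply: leq_sum => v _; exact: hA.
rewrite big_split /= -big_distrl /= sum_nat_const.
rewrite -card_sum_mem.
rewrite expnS mulSn mulnDl leq_add //; first by rewrite leq_mul // ltnW.
by rewrite [leqLHS]mulnCA.
Qed.

(** This brings the two members of a pair, which may sit anywhere in the
sequences that were counted, in front of the summation. *)
Lemma count_seq_insert h1 h2 P :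
  count_seq (h1 + h2.+1) P =
  \sum_(v : V) count_seq (h1 + h2) (fun s => P (take h1 s ++ v :: drop h1 s)).
Proof.
elim: h1 P => [|h1 IH] P.
  rewrite /=; apply: eq_bigr => v _; apply: eq_count_seq => s _.
  by rewrite take0 drop0.
by rewrite addSn /= exchange_big /=; apply: eq_bigr => v _; rewrite IH.
Qed.

(** The non-robust members contribute little, so a large total count yields
many robust members. *)
Lemma count_fibers (I : finType) m h (P : I -> pred (seq V)) :
  (\sum_i count_seq h (P i)) * #|V| <=
    #|[set i | robust m h (P i)]| * #|V| ^ h.+1 + #|I| * (h * m * #|V| ^ h).
Proof.
rewrite big_distrl /= (card_sum_mem [set _ | _]) big_distrl /= -sum_nat_const -big_split /=.
apply: leq_sum => i _; rewrite inE.
case: (boolP (robust _ _ _)) => [_|/count_nonrobust]; last by rewrite mul0n.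
by rewrite mul1n expnSr (leq_trans _ (leq_addr _ _)) // leq_mul // count_seq_le.
Qed.

End Robust.

(** * Cliques of small cost *)

Section LightClique.
Variables (k : nat) (H : kgraph k) (U : {set H}) (D : nat).
Hypothesis k_gt1 : 1 < k.
Hypothesis codegU : forall S : {set H}, S \subset U -> #|S| = k.-1 ->
  #|U :&: nonnbr S| <= D.

Lemma sum_card_draws (Q : {set H}) (q : nat) (F : {set H} -> nat) (m : nat) :
    (forall S : {set H}, S \subset Q -> #|S| = q -> F S <= m) ->
  \sum_(S : {set H} | (S \subset Q) && (#|S| == q)) F S <= 'C(#|Q|, q) * m.
Proof.
move=> hF; rewrite -cards_draws -sum_nat_const.
rewrite [leqRHS](eq_bigl (fun S : {set H} => (S \subset Q) && (#|S| == q))); last first.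
  by move=> S; rewrite inE.
by apply: leq_sum => S /andP[SQ /eqP Sq]; exact: hF.
Qed.

Lemma card_blocked (Q : {set H}) : Q \subset U ->
  #|\bigcup_(S : {set H} | (S \subset Q) && (#|S| == k.-1)) (U :&: nonnbr S)|
    <= 'C(#|Q|, k.-1) * D.
Proof.
move=> QU; apply: leq_trans (leq_card_bigcup _ _) _.
by apply: sum_card_draws => S SQ; apply: codegU; exact: subset_trans QU.
Qed.

Let km1_gt0 : 0 < k.-1. Proof. by rewrite -subn1 subn_gt0. Qed.

Variables (R : realDomainType) (c : H -> R) (t N : nat).
Hypothesis cardU : #|U| = t * N.

Let e : seq H := sort (fun u v => c u <= c v)%R (enum U).

Let mem_e v : (v \in e) = (v \in U).
Proof. by rewrite mem_sort mem_enum. Qed.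

Let uniq_e : uniq e.
Proof. by rewrite sort_uniq enum_uniq. Qed.

Let size_e : size e = t * N.
Proof. by rewrite size_sort -cardE. Qed.

Let e_le v l : v \in U -> l < t * N -> index v e <= l -> (c v <= c (nth v e l))%R.
Proof.
move=> vU l_lt vl; have ve : v \in e by rewrite mem_e.
have tr : transitive (fun u v => c u <= c v)%R by move=> y x z; exact: le_trans.
have so : sorted (fun u v => c u <= c v)%R e.
  by apply: sort_sorted => x y; exact: le_total.
have := sorted_leq_nth tr (fun x => lexx (c x)) v so.
move=> /(_ (index v e) l); rewrite !inE index_mem size_e => /(_ ve l_lt vl).
by rewrite nth_index.
Qed.

Lemma exists_low (B : {set H}) r : r < t * N -> #|B| <= r ->
  exists v, [/\ v \in U, v \notin B & index v e <= r].
Proof.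
move=> r_lt Br; have : #|[set v in take r.+1 e]| = r.+1.
  rewrite cardsE; have /card_uniqP -> := take_uniq r.+1 uniq_e.
  by rewrite size_takel // size_e.
move=> hc; have /subsetPn[v] : ~~ ([set v in take r.+1 e] \subset B).
  by apply/negP => /subset_leq_card; rewrite hc; lia.
rewrite inE => vt vB; exists v; split => //.
  by rewrite -mem_e (mem_take vt).
by have := index_ltn vt; lia.
Qed.

(** The sorted vertices of [U] form [t] consecutive blocks of length [N]; the
[i]-th entry of a list comes no later than the first vertex of block [j + i]. *)
Fixpoint low_from j (s : seq H) : bool :=
  if s is v :: s' then (index v e <= j * N) && low_from j.+1 s' else true.

Lemma low_from_cat j s1 s2 :
  low_from j (s1 ++ s2) = low_from j s1 && low_from (j + size s1) s2.
Proof.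
elim: s1 j => [|v s1 IH] j /=; first by rewrite addn0.
by rewrite IH addSnnS andbA.
Qed.

Lemma low_fromS j s : low_from j s -> low_from j.+1 s.
Proof.
elim: s j => //= v s IH j /andP[vj /IH ->]; rewrite andbT.
by apply: leq_trans vj _; rewrite leq_mul2r leqnSn orbT.
Qed.

(** Each entry costs no more than any vertex of its block. *)
Lemma low_from_cost j s : {subset s <= U} -> low_from j s -> j + size s <= t ->
  (N%:R * \sum_(v <- s) c v <=
    \sum_(j * N <= l < (j + size s) * N) nth 0 [seq c v | v <- e] l)%R.
Proof.
elim: s j => [|v s IH] j sU /=.
  by rewrite addn0 big_nil mulr0 big_geq.
move=> /andP[vj js] jt.
have vU : v \in U by apply: sU; rewrite mem_head.
rewrite big_cons mulrDr (@big_cat_nat _ _ _ (j.+1 * N)) /=; first last.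
- by rewrite leq_mul2r addnS ltnS leq_addr orbT.
- by rewrite leq_mul2r leqnSn orbT.
apply: lerD; last first.
  rewrite addnS -addSn; apply: IH => //; last by rewrite addSnnS.
  by move=> u us; apply: sU; rewrite inE us orbT.
have -> : (N%:R * c v = \sum_(j * N <= l < j.+1 * N) c v)%R.
  by rewrite sumr_const_nat mulr_natl mulSn addnK.
apply: ler_sum_nat => l /andP[l1 l2]; have lt_l : l < t * N.
  by apply: leq_trans l2 _; rewrite leq_mul2r; apply/orP; right; lia.
rewrite (nth_map v) ?size_e //.
by apply: e_le => //; exact: leq_trans l1.
Qed.

Lemma low_cost s : size s = t -> {subset s <= U} -> low_from 0 s ->
  (N%:R * \sum_(v <- s) c v <= \sum_(v in U) c v)%R.
Proof.
move=> st sU s0; have := low_from_cost sU s0; rewrite add0n st leqnn => /(_ isT).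
rewrite mul0n -size_e -(size_map c) -(big_nth 0%R xpredT id) big_map.
rewrite [X in (_ <= X)%R -> _](perm_big (enum U)) ?perm_sort //.
by rewrite big_enum.
Qed.

(** A clique of [j] vertices blocks at most [j + 'C(j, k.-1) * D] vertices, and
block [j] starts with the vertex of rank [j * N]; so a vertex that comes no
later than this one is not blocked. *)
Lemma low_greedy n : n <= t -> 0 < N ->
    (forall j, 0 < j < n -> j + 'C(j, k.-1) * D <= j * N) ->
  exists s, [/\ size s = n, uniq s, {subset s <= U}, clique [set v in s] & low_from 0 s].
Proof.
move=> nt N_gt0; elim: n nt => [|n IH] nt h.
  exists [::]; split=> //; apply: clique_small; rewrite cardsE card0; lia.
have [||s [sn us sU cs ls]] := IH; first by lia.
  by move=> j hj; apply: h; lia.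
set Q := [set v in s] in cs.
have QU : Q \subset U by apply/subsetP => v; rewrite inE => /sU.
have cQ : #|Q| = n by rewrite cardsE (card_uniqP us).
pose B := if n == 0 then set0 else Q :|:
  \bigcup_(S : {set H} | (S \subset Q) && (#|S| == k.-1)) (U :&: nonnbr S).
have B_le : #|B| <= n * N.
  rewrite /B; case: eqP => [_|n0]; first by rewrite cards0.
  have hn : 0 < n < n.+1 by lia.
  apply: leq_trans (h n hn); apply: leq_trans (leq_card_setU _ _) _.
  by rewrite cQ leq_add2l; have := card_blocked QU; rewrite cQ.
have [|v [vU vB vl]] := exists_low _ B_le; first by nia.
have vs : v \notin s.
  move: vB; rewrite /B; case: eqP => [n0 _|_]; last by rewrite !inE negb_or => /andP[].
  by rewrite (size0nil (etrans sn n0)).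
exists (rcons s v); split.
- by rewrite size_rcons sn.
- by rewrite rcons_uniq vs.
- by move=> u; rewrite mem_rcons inE => /predU1P[->|/sU].
- have -> : [set u in rcons s v] = v |: Q.
    by apply/setP => u; rewrite !inE mem_rcons inE.
  apply: clique_setU1 => [|//|S SQ Sk]; first exact: ltnW.
    apply: contra vB => vS.
  rewrite /B; case: eqP => [n0|_].
    by have := subset_leq_card SQ; rewrite Sk cQ n0 leqNgt km1_gt0.
  by rewrite !inE; apply/orP; right; apply/bigcupP; exists S; rewrite ?SQ ?Sk ?eqxx // inE vU.
- by rewrite -cats1 low_from_cat ls sn add0n /= vl.
Qed.

Hypotheses (N_gt0 : 0 < N) (t_ge3 : 2 < t).
Hypothesis greedy_room :
  forall j, 0 < j < t.-1 -> j + 'C(j, k.-1) * D <= j * N.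

(** Having this for all costs [c] is the dual form of a perfect fractional
tiling of [U]. *)
Definition light_clique := exists T : {set H},
  [/\ T \subset U, clique T, #|T| = t & (N%:R * \sum_(v in T) c v <= \sum_(v in U) c v)%R].

Lemma low_light_clique s : size s = t -> uniq s -> {subset s <= U} ->
  clique [set v in s] -> low_from 0 s -> light_clique.
Proof.
move=> st us sU cs ls; exists [set v in s]; split => //.
- by apply/subsetP => v; rewrite inE => /sU.
- by rewrite cardsE (card_uniqP us).
- rewrite (eq_bigl (mem s)) => [|v]; last by rewrite inE.
  by rewrite -(big_uniq _ us); exact: low_cost.
Qed.

Lemma light_clique_greedy :
  t.-1 + 'C(t.-1, k.-1) * D <= t.-1 * N -> light_clique.
Proof.
move=> h; have [|s []] := @low_greedy t (leqnn _) N_gt0; last exact: (@low_light_clique s).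
move=> j /andP[j0 jt]; have [->//|jt'] := eqVneq j t.-1.
by apply: greedy_room; lia.
Qed.

(** Let [Q] be the greedy clique of order [t.-1].  If no vertex of the first
[t.-1] blocks extends [Q], then almost all of these vertices are blocked by a
single [k.-1]-subset of [Q], since there are fewer than [#|U|] incidences in
total.  Two such vertices [u1] and [u2], whose blocking sets [R1] and [R2] share
a vertex [a], extend [Q :\ a] to a clique of order [t] unless a [k.-2]-subset of
[Q] blocks the pair.  The second hypothesis leaves a choice for [u2].  The vertex
[u1] can be taken very cheap, from block 0 or the start of block 1, which pays
for the expensive [u2] in the last block. *)
Lemma light_clique_exchange :
    'C(t.-1, k.-1) * D + 2 * t <= t * N ->
    ('C(t - k.-1, k.-1) + 'C(t.-1, k.-2)) * D <= (t - 2) * N ->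
  light_clique.
Proof.
move=> hA hB.
have [s [st us sU cs ls]] := @low_greedy t.-1 (leq_pred t) N_gt0 greedy_room.
have [s0 [s' sE]] : exists s0 s', s = s0 :: s'.
  by case: s st {us sU cs ls} => [|s0 s' _]; [rewrite /=; lia|exists s0, s'].
set Q := [set v in s] in cs.
have QU : Q \subset U by apply/subsetP => v; rewrite inE => /sU.
have cQ : #|Q| = t.-1 by rewrite cardsE (card_uniqP us).
pose bl u := [set S : {set H} | [&& S \subset Q, #|S| == k.-1 & u \in nonnbr S]].
have sum_bl : \sum_(u in U) #|bl u| <= 'C(t.-1, k.-1) * D.
  rewrite (eq_bigr (fun u => \sum_(S : {set H} | (S \subset Q) && (#|S| == k.-1))
      (u \in nonnbr S : nat))); last first.
    move=> u _; rewrite -sum1_card (eq_bigl (fun S : {set H} =>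
      ((S \subset Q) && (#|S| == k.-1)) && (u \in nonnbr S))).
      by rewrite big_mkcondr /=; apply: eq_bigr => S _; case: (u \in _).
    by move=> S; rewrite inE andbA.
  rewrite exchange_big /= -cQ; apply: sum_card_draws => S SQ Sk.
  rewrite (leq_trans _ (codegU (subset_trans SQ QU) Sk)) //.
  rewrite card_sum_mem big_mkcond /=; apply: leq_sum => u _.
  by rewrite in_setI; case: (u \in U).

  (* the vertices outside [Q] of rank at most [r] *)
  pose L r := [set v in take r.+1 e] :\: Q.
  have cL r : r < t * N -> r.+1 - t.-1 <= #|L r|.
    move=> rt; rewrite cardsD; have -> : #|[set v in take r.+1 e]| = r.+1.
      rewrite cardsE; have /card_uniqP -> := take_uniq r.+1 uniq_e.
      by rewrite size_takel // size_e.
    by rewrite leq_sub2l // -cQ subset_leq_card // subsetIr.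
  have LE r (u : H) : u \in L r -> [/\ u \in U, u \notin s & index u e <= r].
    rewrite !inE => /andP[us' ut]; split => //; first by rewrite -mem_e (mem_take ut).
    by have := index_ltn ut.
  pose r := t.-1 * N.
  have tN : t * N = r + N by rewrite /r -mulSnr prednK // ltnW // ltnW.
  have rt : r < t * N by rewrite tN -addn1 leq_add2l.
  have blE (u : H) (S : {set H}) : S \subset Q -> #|S| = k.-1 -> u \in nonnbr S -> S \in bl u.
    by move=> SQ Sk uS; rewrite inE SQ Sk eqxx uS.
  have add_clique (u : H) (A : {set H}) : A \subset Q -> (forall S, S \in bl u -> ~~ (S \subset A)) -> clique (u |: A).
    move=> AQ hS; apply: clique_setU1 => [||S SA Sk]; first exact: ltnW.
      exact: clique_sub cs.
    by apply/negP => uS; have /hS := blE _ _ (subset_trans SA AQ) Sk uS; rewrite SA.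
  case: (boolP [exists u, (u \in L r) && (bl u == set0)]) => [/existsP[u /andP[uL /eqP bu]]|/existsPn all_bl].
  have [uU us' ur] := LE _ _ uL.
  apply: (@low_light_clique (rcons s u)).
  - by rewrite size_rcons st prednK // ltnW // ltnW.
  - by rewrite rcons_uniq us'.
  - by move=> w; rewrite mem_rcons inE => /predU1P[->|/sU].
  - have -> : [set w in rcons s u] = u |: Q.
      by apply/setP => w; rewrite in_setU1 !in_set mem_rcons in_cons.
    by apply: add_clique => // S; rewrite bu inE.
  - by rewrite -cats1 low_from_cat ls st add0n /= andbT.
have bl_gt0 u : u \in L r -> 0 < #|bl u|.
  by move=> uL; have := all_bl u; rewrite uL /= card_gt0.
(* every vertex counted by [L r] is blocked at least once, so the incidences
   leave room for fewer than [N] vertices that are blocked twice *)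
pose Lmany := [set u in L r | 1 < #|bl u|].
have LrU : L r \subset U by apply/subsetP => u /LE[].
have cmany : #|Lmany| + t < N.
  have : #|L r| + #|Lmany| <= \sum_(u in U) #|bl u|.
    rewrite (big_setID (L r)) /= (setIidPr LrU).
    apply: leq_trans (leq_addr _ _).
    have -> : #|Lmany| = \sum_(u in L r) (1 < #|bl u|).
      rewrite card_sum_mem [RHS]big_mkcond; apply: eq_bigr => u _; rewrite in_set.
      by case: (u \in L r).
    rewrite -sum1_card -big_split /=; apply: leq_sum => u /bl_gt0.
    by case: #|bl u| => [|[]].
  by move: (cL _ rt) sum_bl hA tN; clear; lia.


have [u1 [u1L u1bl u1r]] : exists u, [/\ u \in L r, #|bl u| = 1 & index u e <= N].
  have Nt : N < t * N by rewrite ltn_Pmull // ltnW.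
  have /subsetPn[u uL uM] : ~~ (L N \subset Lmany).
    by apply/negP => /subset_leq_card; move: (cL _ Nt) cmany; clear; lia.
  have [uU us' ur] := LE _ _ uL.
  have uLr : u \in L r.
    rewrite in_setD !in_set us' in_take ?mem_e //= ltnS (leq_trans ur) //.
    by rewrite /r leq_pmull // -subn1 subn_gt0 ltnW.
  exists u; split => //; move: uM; rewrite in_set uLr /= -leqNgt => uM.
  by apply/eqP; rewrite eqn_leq uM bl_gt0.
have /cards1P[R1 blR1] : #|bl u1| == 1 by rewrite u1bl.
have : R1 \in bl u1 by rewrite blR1 inE.
rewrite inE => /and3P[R1Q /eqP cR1 u1R1].
have [u1U u1s _] := LE _ _ u1L.
(* [Xs] and [Rs] are the obstacles for [u2]: pairs blocked with [u1], and
   blocking sets that meet [R1] at most in [s0]; the cheapest vertex [s0] is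
   kept because only it fits into block 0 *)
pose Xs := \bigcup_(X : {set H} | (X \subset Q) && (#|X| == k.-2)) (U :&: nonnbr (u1 |: X)).
pose Rs := \bigcup_(S : {set H} | (S \subset Q :\: (R1 :\ s0)) && (#|S| == k.-1)) (U :&: nonnbr S).
have cXs : #|Xs| <= 'C(t.-1, k.-2) * D.
  rewrite -cQ; apply: leq_trans (leq_card_bigcup _ _) _.
  apply: sum_card_draws => X XQ cX; apply: codegU.
    by rewrite subUset sub1set u1U (subset_trans XQ).
  rewrite cardsU1 cX (contra (subsetP XQ u1)) ?inE //.
  by rewrite -[in RHS](prednK km1_gt0).
have cRs : #|Rs| <= 'C(t - k.-1, k.-1) * D.
  apply: leq_trans (card_blocked _) _; first by rewrite (subset_trans (subsetDl _ _)).
  rewrite leq_mul2r leq_bin2l ?orbT // cardsDS; last by rewrite (subset_trans (subD1set _ _)).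
  rewrite cQ; have := cardsD1 s0 R1; rewrite cR1; move: km1_gt0 t_ge3; clear; case: (s0 \in R1) => /=; lia.
have [u2 u2L u2B] : exists2 u, u \in L r & u \notin [set u1] :|: (Lmany :|: (Rs :|: Xs)).
  have /subsetPn[u uL uM] : ~~ (L r \subset [set u1] :|: (Lmany :|: (Rs :|: Xs))); last by exists u.
  apply/negP => /subset_leq_card hc.
  have := leq_trans (cL _ rt) hc; apply/negP; rewrite -ltnNge.
  apply: leq_ltn_trans (leq_card_setU _ _) _; rewrite cards1.
  have := (leq_card_setU Lmany (Rs :|: Xs)).1; have := (leq_card_setU Rs Xs).1.
  have rE : r = (t - 2) * N + N by rewrite -mulSnr /r; congr (_ * _); move: t_ge3; clear; lia.
  move: hB cRs cXs cmany t_ge3 rE; rewrite mulnDl; clear; lia.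
have [u2U u2s u2r] := LE _ _ u2L.
move: u2B; rewrite !in_setU in_set1 in_set !negb_or u2L /= -leqNgt => /and4P[u21 u2bl u2Rs u2Xs].
have /cards1P[R2 blR2] : #|bl u2| == 1 by rewrite eqn_leq u2bl bl_gt0.
have : R2 \in bl u2 by rewrite blR2 inE.
rewrite inE => /and3P[R2Q /eqP cR2 u2R2].
have [a aR2] : exists2 a, a \in R2 & a \in R1 :\ s0.
  apply/exists_inP; apply: contraT => /exists_inPn R12; case/negP: u2Rs; apply/bigcupP; exists R2.
    rewrite cR2 eqxx andbT; apply/subsetP => w wR2.
    by rewrite inE R12 //= (subsetP R2Q).
  by rewrite inE u2U.
rewrite inE => /andP[as0 aR1]; rewrite inE in as0.
have : a \in s' by have := subsetP R1Q _ aR1; rewrite !inE sE inE (negbTE as0).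
move=> as'; case/splitPr: as' sE => p1 p2 sE.
set s'' := s0 :: p1 ++ p2.
have ps : perm_eq s (a :: s'').
  by rewrite sE; apply/permPl; exact: (perm_catCA (s0 :: p1) [:: a] p2).
have /andP[as'' us''] : uniq (a :: s'') by rewrite -(perm_uniq ps).
have sQ : [set v in s''] = Q :\ a.
  apply/setP => w; rewrite in_setD1 !in_set (perm_mem ps) [w \in a :: _]in_cons.
  by case: eqP => [->|//]; rewrite (negbTE as'').
have cQ1 : clique (u1 |: (Q :\ a)).
  apply: add_clique => [|S]; first exact: subD1set.
  rewrite blR1 => /set1P->; apply/negP => /subsetP/(_ a aR1).
  by rewrite in_setD1 eqxx.
have cQ2 : clique (u2 |: (u1 |: (Q :\ a))).
  apply: clique_setU1 => [|//|S SQ cS]; first exact: ltnW.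
  apply/negP => u2S; have [u1S|u1S] := boolP (u1 \in S).
    case/negP: u2Xs; apply/bigcupP; exists (S :\ u1); last by rewrite setD1K // inE u2U.
    apply/andP; split.
      apply/subsetP => w /setD1P[wu1 /(subsetP SQ)]; rewrite in_setU1 (negbTE wu1).
      by case/setD1P.
    by move: (cardsD1 u1 S); rewrite u1S cS => e1; rewrite e1.
  have SQa : S \subset Q :\ a.
    apply/subsetP => w wS; have := subsetP SQ _ wS; rewrite in_setU1.
    by case/predU1P => // wu1; rewrite -wu1 wS in u1S.
  have := blE _ _ (subset_trans SQa (subD1set _ _)) cS u2S; rewrite blR2 => /set1P SR2.
  by have := subsetP SQa a; rewrite SR2 aR2 in_setD1 eqxx => /(_ isT).
(* compared with the greedy list, the vertices before [a] move to the next
   block, and those after [a] stay where they were *)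
set f := s0 :: u1 :: p1 ++ p2 ++ [:: u2].
have pf : perm_eq f (u2 :: u1 :: s'').
  by apply/permP => p; rewrite /f /s'' /= !count_cat /=; clear; lia.
have sfE : (size p1 + size p2).+2 = t.-1.
  by rewrite -st sE /= size_cat /= addnS.
have s''s : {subset s'' <= s} by move=> w ws; rewrite (perm_mem ps) in_cons ws orbT.
apply: (@low_light_clique f).
- by rewrite (perm_size pf) /s'' /= size_cat sfE prednK ?(ltn_trans _ t_ge3).
- rewrite (perm_uniq pf) /= us'' andbT in_cons negb_or u21 /=.
  by rewrite !(contra (s''s _)).
- move=> w; rewrite (perm_mem pf) !in_cons => /predU1P[->//|/predU1P[->//|/s''s]].
  exact: sU.
- have -> : [set v in f] = u2 |: (u1 |: (Q :\ a)) => //.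
  by apply/setP => w; rewrite -sQ !in_setU1 !in_set (perm_mem pf) !in_cons.
- move: ls; rewrite sE /= !low_from_cat /= => /and4P[-> lp1 _ lp2].
  rewrite mul1n u1r (low_fromS lp1) /= andbT.
  rewrite (_ : 2 + size p1 = (1 + size p1).+1) // lp2 /=.
  by rewrite (leq_trans u2r) // /r -sfE add1n !addSn.
Qed.

End LightClique.

(** * Connecting pairs of vertices *)

Section Connect.
Variables (k : nat) (H : kgraph k) (D : nat).
Hypothesis k_gt1 : 1 < k.
Hypothesis codeg : forall S : {set H}, #|S| = k.-1 -> #|nonnbr S| <= D.
Implicit Types (s Q S : seq H) (m h t : nat).

Fixpoint all_from (W : nat -> {set H}) j s : bool :=
  if s is v :: s' then (v \in W j) && all_from W j.+1 s' else true.

Lemma all_from_nth W j s x0 i : all_from W j s -> i < size s -> nth x0 s i \in W (j + i).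
Proof.
elim: s j i => //= v s IH j [|i] /andP[vW sW]; first by rewrite addn0.
by rewrite ltnS addnS -addSn; exact: IH.
Qed.

Lemma all_from_card (W : nat -> {set H}) (B : {set H}) s i l : uniq s -> all_from W 0 s ->
    i + l <= size s -> (forall j, i <= j < i + l -> W j = B) ->
  l <= #|[set v in s] :&: B|.
Proof.
move=> us sW il hB; pose s' := take l (drop i s).
have s'l : size s' = l by rewrite size_takel // size_drop leq_subRL // (leq_trans (leq_addr _ _) il).
have us' : uniq s' by rewrite take_uniq // drop_uniq.
rewrite -{1}s'l -(card_uniqP us') -cardsE; apply: subset_leq_card; apply/subsetP => v.
rewrite !inE => vs'; rewrite (mem_drop (mem_take vs')) /=.
have jl : index v s' < l by rewrite -s'l index_mem.
have := nth_index v vs'; rewrite nth_take // nth_drop => <-.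
rewrite -(hB (i + index v s')); last by rewrite leq_addr ltn_add2l.
by apply: all_from_nth sW _; rewrite (leq_trans _ il) // ltn_add2l.
Qed.

Lemma sum_card_draws_nonnbr (T : {set H}) (P : pred {set H}) :
  \sum_(S : {set H} | [&& S \subset T, #|S| == k.-1 & P S]) #|nonnbr S| <=
  #|[set S : {set H} | [&& S \subset T, #|S| == k.-1 & P S]]| * D.
Proof.
rewrite -sum_nat_const; rewrite [leqRHS](eq_bigl (fun S : {set H} => [&& S \subset T, #|S| == k.-1 & P S])).
  by apply: leq_sum => S /and3P[_ /eqP Sk _]; exact: codeg.
by move=> S; rewrite inE.
Qed.

Lemma card_extensions (Q W : {set H}) :
  #|W| <= #|[set v in W | (v \notin Q) && [forall S : {set H},
     (S \subset Q) && (#|S| == k.-1) ==> (v \notin nonnbr S)]]| + #|Q| + 'C(#|Q|, k.-1) * D.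
Proof.
set E := [set v in W | _].
pose B := \bigcup_(S : {set H} | [&& S \subset Q, #|S| == k.-1 & true]) nonnbr S.
have cB : #|B| <= 'C(#|Q|, k.-1) * D.
  have h : #|[set S : {set H} | [&& S \subset Q, #|S| == k.-1 & true]]| = 'C(#|Q|, k.-1).
    by rewrite -cards_draws; apply: eq_card => S; rewrite !inE andbT.
  rewrite -h; apply: leq_trans (sum_card_draws_nonnbr _ _).
  exact: leq_card_bigcup.
have WE : W \subset E :|: (Q :|: B).
  apply/subsetP => v vW; rewrite !in_setU inE vW /=.
  have [//|vQ] := boolP (v \in Q); rewrite ?orbT //=.
  have [vB|vB] := boolP (v \in B); rewrite ?orbT // orbF.
  apply/forallP => S; apply/implyP => /andP[SQ Sk]; apply: contra vB => vS.
  by apply/bigcupP; exists S; rewrite ?SQ ?Sk.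
apply: leq_trans (subset_leq_card WE) _.
apply: leq_trans (leq_card_setU _ _).1 _; rewrite -addnA leq_add2l.
apply: leq_trans (leq_card_setU _ _).1 _; by rewrite leq_add2l.
Qed.

Lemma robust_clique (W : nat -> {set H}) m h Q : uniq Q -> clique [set v in Q] ->
    (forall j, size Q <= j < size Q + h -> m + j + 'C(j, k.-1) * D <= #|W j|) ->
  robust m h (fun s => [&& uniq (s ++ Q), clique [set v in s ++ Q] & all_from W (size Q) s]).
Proof.
elim: h Q => [|h IH] Q uQ cQ hW /=; first by rewrite uQ cQ.
set E := [set v in W (size Q) | (v \notin [set v in Q]) && [forall S : {set H},
     (S \subset [set v in Q]) && (#|S| == k.-1) ==> (v \notin nonnbr S)]].
have mE : m <= #|E|.
  have := card_extensions [set v in Q] (W (size Q)); rewrite -/E.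
  have -> : #|[set v in Q]| = size Q by rewrite cardsE (card_uniqP uQ).
  have := hW (size Q); rewrite leqnn /= -[X in X < _]addn0 ltn_add2l => /(_ isT).
  clear; lia.
apply: leq_trans mE _; apply: subset_leq_card; apply/subsetP => v.
rewrite !inE => /and3P[vW vQ /forallP vS].
have {}IH := IH (v :: Q); apply: robust_impl (IH _ _ _) => //.
- move=> s _ /and3P[us cs hs]; rewrite vW /= (_ : v \notin s ++ Q).
    rewrite (_ : uniq (s ++ Q)) /=; first rewrite hs andbT.
      suff -> : [set w in v :: s ++ Q] = [set w in s ++ v :: Q] by [].
      by apply/setP => w; rewrite !in_set in_cons !mem_cat in_cons orbCA.
    by move: us; rewrite !cat_uniq /= => /and3P[-> /norP[_ ->] /andP[_ ->]].
  by move: us; rewrite cat_uniq mem_cat /= => /and3P[_ /norP[/negbTE-> _] /andP[/negbTE-> _]].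
- by rewrite /= vQ.
- have -> : [set w in v :: Q] = v |: [set w in Q] by apply/setP => w; rewrite !inE.
  apply: clique_setU1 => [||S SQ Sk]; [exact: ltnW|by []|].
  by have := vS S; rewrite SQ Sk eqxx.
- by move=> j /= hj; apply: hW; move: hj; rewrite addSnnS => /andP[/ltnW -> ->].
Qed.

Variable t : nat.
Hypothesis t_gt1 : 1 < t.

Definition mono (A S : {set H}) : bool := (S \subset A) || (S \subset ~: A).

Definition crossing (A T : {set H}) (u : H) : bool :=
  [exists a in T, [&& (a \in A) != (u \in A), u \notin T & clique (u |: T :\ a)]].

Lemma card_mono (A T : {set H}) : 0 < k.-1 ->
  #|[set S : {set H} | [&& S \subset T, #|S| == k.-1 & mono A S]]| <=
    'C(#|T :&: A|, k.-1) + 'C(#|T :\: A|, k.-1).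
Proof.
move=> x_gt0; rewrite -!cards_draws; apply: leq_trans (leq_card_setU _ _).1.
apply: subset_leq_card; apply/subsetP => S.
rewrite !inE => /and3P[ST -> /orP[SA|SA]]; rewrite !andbT; apply/orP; [left|right].
  by rewrite subsetI ST.
by rewrite setDE subsetI ST.
Qed.

(** A vertex [u] that is blocked by no [k.-1]-subset of [T] can replace any
vertex of [T], and one that is blocked by [R] alone can replace any vertex of
[R].  Hence a vertex outside [T] that replaces no vertex of the other part is
blocked twice, or once by a subset within a part; counting the latter twice, it
gets a weight of at least [2], and the total weight is bounded. *)
Lemma many_crossing (A T : {set H}) m mu : clique T -> #|T| = t ->
    0 < #|T :&: A| -> 0 < #|T :\: A| ->
    'C(#|T :&: A|, k.-1) + 'C(#|T :\: A|, k.-1) <= mu ->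
    2 * (m + t) + ('C(t, k.-1) + mu) * D <= 2 * #|H| ->
  m <= #|[set u | crossing A T u]|.
Proof.
move=> cT Tt /card_gt0P[a1 a1A] /card_gt0P[a2 a2A] hmu hm.
have x_gt0 : 0 < k.-1 by move: k_gt1; clear; lia.
set C := [set u | _].
pose bl P u := \sum_(S : {set H} | [&& S \subset T, #|S| == k.-1 & P S]) (u \in nonnbr S : nat).
have sum_bl P : \sum_u bl P u <= #|[set S : {set H} | [&& S \subset T, #|S| == k.-1 & P S]]| * D.
  rewrite exchange_big /=; apply: leq_trans (sum_card_draws_nonnbr _ _).
  by apply: leq_sum => S _; rewrite card_sum_mem.
have s1 := sum_bl predT; have s2 := sum_bl (mono A).
have h1 : #|[set S : {set H} | [&& S \subset T, #|S| == k.-1 & predT S]]| = 'C(t, k.-1).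
  by rewrite -Tt -cards_draws; apply: eq_card => S; rewrite !inE andbT.
rewrite h1 in s1.
have h2 := leq_trans (card_mono A T x_gt0) hmu.
have {}s2 := leq_trans s2 (leq_mul h2 (leqnn D)).
have key u : u \in ~: (C :|: T) -> 2 <= bl predT u + bl (mono A) u.
  rewrite in_setC in_setU negb_or in_set => /andP[uC uT].
  have block a : a \in T -> (a \in A) != (u \in A) -> exists S : {set H},
      [/\ S \subset T, #|S| == k.-1, u \in nonnbr S & a \notin S].
    move=> aT au; have ncl : ~~ clique (u |: T :\ a).
      by apply: contra uC => cl; apply/exists_inP; exists a => //; rewrite au uT.
    case: (pickP (fun S : {set H} => [&& S \subset T :\ a, #|S| == k.-1 & u \in nonnbr S])).
      move=> S /and3P[ST Sk uS]; exists S; rewrite Sk uS (subset_trans ST (subD1set _ _)).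
      by split=> //; apply/negP => /(subsetP ST); rewrite !inE eqxx.
    move=> none; case/negP: ncl; apply: clique_setU1 => [||S ST Sk]; first exact: ltnW.
      exact: clique_sub (subD1set _ _) cT.
    by have := none S; rewrite ST Sk eqxx /= => ->.
  have [a aT au] : exists2 a, a \in T & (a \in A) != (u \in A).
    move: a1A a2A; rewrite !inE => /andP[a1T a1A] /andP[a2A a2T].
    have [uA|uA] := boolP (u \in A); [exists a2|exists a1] => //.
      by rewrite (negbTE a2A).
    by rewrite a1A.
  (* [a] is on the other side than [u], so some blocking set avoids [a]; if it
     is not within a part, it contains a vertex [b] on the other side, and a
     second blocking set avoids [b] *)
  have [S [ST Sk uS aS]] := block a aT au.
  have [mS|mS] := boolP (mono A S).
    rewrite /bl (bigD1 S) /=; last by rewrite ST Sk.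
    rewrite [X in _ + X](bigD1 S) /=; last by rewrite ST Sk mS.
    by rewrite uS addnACA leq_addr.
  have [b bS bu] : exists2 b, b \in S & (b \in A) != (u \in A).
    move: mS; rewrite negb_or => /andP[/subsetPn[b1 b1S b1A] /subsetPn[b2 b2S b2A]].
    rewrite inE negbK in b2A.
    have [uA|uA] := boolP (u \in A); [exists b1|exists b2] => //.
      by rewrite (negbTE b1A).
    by rewrite b2A.
  have [S' [ST' Sk' uS' bS']] := block b (subsetP ST _ bS) bu.
  have SS' : S' != S by apply: contraNneq bS' => ->.
  rewrite /bl (bigD1 S) /=; last by rewrite ST Sk.
  rewrite (bigD1 S') /=; last by rewrite ST' Sk' SS'.
  by rewrite uS uS' addnA -addnA leq_addr.
have : 2 * #|~: (C :|: T)| <= 'C(t, k.-1) * D + mu * D.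
  rewrite mulnC -sum_nat_const; apply: leq_trans (leq_add s1 s2).
  rewrite -big_split /= big_mkcond /=; apply: leq_sum => u _.
  by case: ifP => // /key.
have := cardsCs (C :|: T); have := (leq_card_setU C T).1; rewrite Tt.
move: hm; rewrite mulnDl; have := subset_leq_card (subsetT (C :|: T)); rewrite cardsT; clear; lia.
Qed.

Definition link (x y : H) s : bool :=
  [&& uniq (x :: y :: s), clique [set v in x :: s] & clique [set v in y :: s]].

Lemma linkC x y s : link x y s = link y x s.
Proof.
rewrite /link (andbC (clique [set v in x :: s])).
suff -> : uniq (x :: y :: s) = uniq (y :: x :: s) by [].
by rewrite /= !in_cons !negb_or [y == x]eq_sym !andbA; congr (_ && _); rewrite andbAC.
Qed.

(** A connection between [x] and [y]: a tiling that contains [s] can cover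
either of them and leave the other one free. *)
Definition swaps s x y : bool :=
  [&& uniq s, x \notin s, y \notin s, `[< tileable t (x |: [set v in s]) >] &
      `[< tileable t (y |: [set v in s]) >]].

Lemma link_swaps x y s : size s = t.-1 -> link x y s -> swaps s x y.
Proof.
move=> st; rewrite /link /= !inE !negb_or => /and3P[/andP[/andP[_ xs] /andP[ys us]] cx cy].
rewrite /swaps us xs ys /=.
have h z : z \notin s -> clique [set v in z :: s] -> tileable t (z |: [set v in s]).
  move=> zs cz; have E : z |: [set v in s] = [set v in z :: s] by apply/setP => w; rewrite !inE.
  apply: tileable_clique; first exact: ltnW.
    by rewrite E.
  by rewrite cardsU1 inE zs cardsE (card_uniqP us) st; move: t_gt1; clear; lia.
by apply/andP; split; apply/asboolP; apply: h.
Qed.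

(** The clique [T] is chosen with its first [q] vertices outside [A], the next
[p] in [A] and the others anywhere; [many_crossing] then offers the choices for
the last entry, which replaces the entry [i] of [T]. *)
Lemma robust_crossing (A : {set H}) m mu p q :
    0 < p -> 0 < q -> p + q <= t ->
    (forall j, j < q -> m + j + 'C(j, k.-1) * D <= #|~: A|) ->
    (forall j, q <= j < p + q -> m + j + 'C(j, k.-1) * D <= #|A|) ->
    (forall j, p + q <= j < t -> m + j + 'C(j, k.-1) * D <= #|H|) ->
    2 * (m + t) + ('C(t, k.-1) + mu) * D <= 2 * #|H| ->
    (forall a b, a + b = t -> p <= a -> q <= b -> 'C(a, k.-1) + 'C(b, k.-1) <= mu) ->
  robust m (t + 1) (fun s => [exists i : 'I_t, forall x0 : H, 
    ((nth x0 s i \in A) != (nth x0 s t \in A)) &&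
    link (nth x0 s i) (nth x0 s t) (take i s ++ drop i.+1 (take t s))]).
Proof.
move=> p_gt0 q_gt0 pqt hB hA hV hm hmu.
pose W j := if j < q then ~: A else if j < p + q then A else setT.
have hW j : 0 <= j < 0 + t -> m + j + 'C(j, k.-1) * D <= #|W j|.
  rewrite add0n /= => jt; rewrite /W; case: ltnP => jq; first exact: hB.
  case: ltnP => jpq; first by apply: hA; rewrite jq.
  by rewrite cardsT; apply: hV; rewrite jpq.
have c0 : clique [set v in ([::] : seq H)].
  by apply: clique_small; rewrite cardsE card0; apply: ltnW.
have := robust_clique (isT : uniq [::]) c0 hW; rewrite robust_cat.
apply: robust_impl => // T Tt; rewrite cats0 => /and3P[uT cT WT].
have cardT : #|[set v in T]| = t by rewrite cardsE (card_uniqP uT).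
have cB : q <= #|[set v in T] :\: A|.
  rewrite setDE; apply: (@all_from_card W _ T 0) => //.
    by rewrite add0n Tt (leq_trans _ pqt) // leq_addl.
  by move=> j; rewrite add0n /W => /= ->.
have cA : p <= #|[set v in T] :&: A|.
  apply: (@all_from_card W _ T q) => //; first by rewrite Tt addnC.
  by move=> j /andP[qj jpq]; rewrite /W ltnNge qj /= addnC jpq.
have E : #|[set v in T] :&: A| + #|[set v in T] :\: A| = t by rewrite cardsID.
have := many_crossing cT cardT (leq_trans p_gt0 cA) (leq_trans q_gt0 cB) (hmu _ _ E cA cB) hm.
move=> mC; rewrite /=; apply: leq_trans mC _; apply: subset_leq_card; apply/subsetP => u.
rewrite !inE => /exists_inP[a]; rewrite inE => aT /and3P[au uT' cu].
have iT : index a T < t by rewrite -Tt index_mem.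
apply/existsP; exists (Ordinal iT); apply/forallP => x0 /=.
have -> : nth x0 (T ++ [:: u]) (index a T) = a by rewrite nth_cat Tt iT nth_index.
have -> : nth x0 (T ++ [:: u]) t = u by rewrite nth_cat Tt ltnn subnn.
have -> : take (index a T) (T ++ [:: u]) = take (index a T) T.
  by rewrite takel_cat // Tt ltnW.
have -> : take t (T ++ [:: u]) = T by rewrite -Tt take_size_cat.
rewrite au /=; set s := take _ _ ++ _.
have ps : perm_eq T (a :: s).
  rewrite -{1}(cat_take_drop (index a T) T) (drop_nth a) ?Tt // nth_index //.
  by apply/permPl; exact: (perm_catCA _ [:: a]).
have uas : uniq (a :: s) by rewrite -(perm_uniq ps).
have uu : u \notin a :: s by rewrite -(perm_mem ps); move: uT'; rewrite ?in_set.
apply/and3P; split.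
- move: uas uu; rewrite /= !in_cons !negb_or => /andP[-> ->] /andP[ua ->].
  by rewrite eq_sym ua.
- by have <- : [set v in T] = [set v in a :: s] by apply/setP => v; rewrite !in_set (perm_mem ps).
- suff <- : u |: [set v in T] :\ a = [set v in u :: s] by [].
  apply/setP => v; rewrite in_setU1 in_setD1 !in_set (perm_mem ps) !in_cons.
  case: (eqVneq v u) => //= _; case: (eqVneq v a) => //= ->.
  by move: uas => /andP[/negbTE].
Qed.

Lemma swaps_pad x y s (T : seq H) : uniq T -> size T = t -> clique [set v in T] ->
  all [predC (x |: (y |: [set v in s]))] T -> swaps s x y -> swaps (s ++ T) x y.
Proof.
move=> uT Tt cT /allP avoid /and5P[us xs ys /asboolP tx /asboolP ty].
have av v : v \in T -> [&& v != x, v != y & v \notin s].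
  by move=> /avoid; rewrite /= !inE !negb_or.
have tT : tileable t [set v in T].
  by apply: tileable_clique => //; [exact: ltnW|rewrite cardsE (card_uniqP uT)].
have h z : z \in [:: x; y] -> tileable t (z |: [set v in s]) -> tileable t (z |: [set v in s ++ T]).
  move=> zxy tz; have -> : z |: [set v in s ++ T] = (z |: [set v in s]) :|: [set v in T].
    by apply/setP => v; rewrite !inE mem_cat orbA.
  apply: tileableU => //; rewrite disjoint_sym disjoints_subset; apply/subsetP => v.
  rewrite !inE negb_or => /av /and3P[vx vy ->]; rewrite andbT.
  by move: zxy; rewrite !inE => /orP[]/eqP->.
apply/and5P; split; rewrite ?mem_cat ?negb_or ?xs ?ys /=.
- rewrite cat_uniq us uT andbT; apply/hasPn => v /av /and3P[_ _ //].
- by apply/negP => /av; rewrite eqxx.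
- by apply/negP => /av; rewrite eqxx andbF.
- by apply/asboolP; apply: h => //; rewrite !inE eqxx.
- by apply/asboolP; apply: h => //; rewrite !inE eqxx orbT.
Qed.

(** The middle vertex [z] is covered together with [s1] when [y] is to be
covered, and together with [s2] when [x] is. *)
Lemma swaps_trans x y z s1 s2 : x != z -> y \notin z :: s1 -> x \notin s2 ->
    all [predC [set v in s1]] s2 -> swaps s1 x z -> swaps s2 z y -> swaps (z :: s1 ++ s2) x y.
Proof.
move=> xz; rewrite inE negb_or => /andP[yz ys1] xs2 /allP dis.
move=> /and5P[us1 xs1 zs1 /asboolP tx /asboolP tz] /and5P[us2 zs2 ys2 /asboolP tz' /asboolP ty].
have dis' v : v \in s2 -> v \notin s1 by move=> /dis; rewrite /= inE.
apply/and5P; split.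
- rewrite /= mem_cat negb_or zs1 zs2 cat_uniq us1 us2 !andbT /=; apply/hasPn => v; exact: dis'.
- by rewrite inE mem_cat !negb_or xz xs1.
- by rewrite inE mem_cat !negb_or yz ys1.
- apply/asboolP; have -> : x |: [set v in z :: s1 ++ s2] = (x |: [set v in s1]) :|: (z |: [set v in s2]).
    apply/setP => v; rewrite !inE mem_cat; by do !case: (_ == _); do !case: (_ \in _).
  apply: tileableU => //; rewrite disjoints_subset; apply/subsetP => v; rewrite !inE negb_or.
  case/orP => [/eqP->|vs1]; first by rewrite xz.
  by rewrite (contraNneq _ zs1) => [|<-//]; apply: contraL vs1; exact: dis'.
- apply/asboolP; have -> : y |: [set v in z :: s1 ++ s2] = (z |: [set v in s1]) :|: (y |: [set v in s2]).
    apply/setP => v; rewrite !inE mem_cat; by do !case: (_ == _); do !case: (_ \in _).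
  apply: tileableU => //; rewrite disjoints_subset; apply/subsetP => v; rewrite !inE negb_or.
  case/orP => [/eqP->|vs1]; first by rewrite eq_sym yz.
  by rewrite (contraNneq _ ys1) => [|<-//]; apply: contraL vs1; exact: dis'.
Qed.

Definition cross_link (A : {set H}) (p : H * H) s : bool :=
  ((p.1 \in A) != (p.2 \in A)) && link p.1 p.2 s.

Lemma crossing_count (x0 : H) (A : {set H}) m :
    robust m (t + 1) (fun s => [exists i : 'I_t, forall x0 : H,
      ((nth x0 s i \in A) != (nth x0 s t \in A)) &&
      link (nth x0 s i) (nth x0 s t) (take i s ++ drop i.+1 (take t s))]) ->
  m ^ t.+1 <= t * \sum_(p : H * H) count_seq t.-1 (cross_link A p).
Proof.
move=> /robust_count; rewrite addn1 => /leq_trans; apply.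
pose Q (i : 'I_t) s := cross_link A (nth x0 s i, nth x0 s t) (take i s ++ drop i.+1 (take t s)).
apply: (@leq_trans (count_seq t.+1 (fun s => [exists i, Q i s]))).
  apply: leq_count_seq => s _ /existsP[i /forallP/(_ x0) h]; apply/existsP; exists i; exact: h.
apply: leq_trans (count_seq_has _ _) _.
have Qi (i : 'I_t) : count_seq t.+1 (Q i) = \sum_(p : H * H) count_seq t.-1 (cross_link A p).
  rewrite -[t.+1]addn1 count_seq_insert -(pair_bigA _ (fun a u => count_seq t.-1 (cross_link A (a, u)))).
  rewrite [RHS]exchange_big; apply: eq_bigr => u _ /=.
  transitivity (count_seq t (fun s => cross_link A (nth x0 s i, u) (take i s ++ drop i.+1 s))).
    rewrite addn0; apply: eq_count_seq => s st; rewrite /Q.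
    rewrite take_oversize ?st // drop_oversize ?st //.
    rewrite nth_cat st ltn_ord nth_cat st ltnn subnn /=.
    by rewrite takel_cat ?st 1?ltnW // take_cat st ltnn subnn take0 cats0.
  have it := ltn_ord i.
  have tE : t = i + (t.-1 - i).+1 by move: it; clear; lia.
  have tE' : i + (t.-1 - i) = t.-1 by move: it; clear; lia.
  rewrite {1}tE count_seq_insert tE'; apply: eq_bigr => a _; apply: eq_count_seq => s st.
  have si : size (take i s) = i by rewrite size_takel // st -tE' leq_addr.
  rewrite nth_cat si ltnn subnn /= -[X in take X (_ ++ _)]si take_size_cat //.
  rewrite drop_cat si ltnNge leqnSn /= subSnn /= drop0; congr (cross_link A _ _).
  by rewrite cat_take_drop.
by rewrite (eq_bigr _ (fun i _ => Qi i)) sum_nat_const card_ord.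
Qed.

(** All crossing sequences of length [t.+1] are counted according to their
crossing pair, which leaves a sequence that links the pair.  The factor [2]
stands for the two orders of the pair. *)
Lemma robust_cut (x0 : H) (A : {set H}) m mu p q m' :
    0 < p -> 0 < q -> p + q <= t ->
    (forall j, j < q -> m + j + 'C(j, k.-1) * D <= #|~: A|) ->
    (forall j, q <= j < p + q -> m + j + 'C(j, k.-1) * D <= #|A|) ->
    (forall j, p + q <= j < t -> m + j + 'C(j, k.-1) * D <= #|H|) ->
    2 * (m + t) + ('C(t, k.-1) + mu) * D <= 2 * #|H| ->
    (forall a b, a + b = t -> p <= a -> q <= b -> 'C(a, k.-1) + 'C(b, k.-1) <= mu) ->
    0 < m' ->
  m ^ t.+1 * #|H| <=
    t * (2 * #|[set p : H * H | [&& p.1 \in A, p.2 \notin A & robust m' t.-1 (link p.1 p.2)]]| * #|H| ^ t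
         + #|H| ^ 2 * (t.-1 * m' * #|H| ^ t.-1)).
Proof.
move=> p_gt0 q_gt0 pqt hB hA hV hm hmu m'_gt0.
have h := crossing_count x0 (robust_crossing p_gt0 q_gt0 pqt hB hA hV hm hmu).
apply: leq_trans (leq_mul h (leqnn _)) _; rewrite -mulnA leq_mul2l; apply/orP; right.
apply: leq_trans (count_fibers m' _ _) _; rewrite card_prod mulnn prednK ?(ltnW t_gt1) //.
rewrite leq_add2r leq_mul2r; apply/orP; right.
set X := [set p | _ & _].
rewrite mul2n -addnn; apply: leq_trans (leq_add (leqnn _) (leq_imset_card (fun p : H * H => (p.2, p.1)) X)).
apply: leq_trans (leq_card_setU _ _).1.
apply: subset_leq_card; apply/subsetP => -[a u]; rewrite inE => r.
have /andP[au rl] : ((a \in A) != (u \in A)) && robust m' t.-1 (link a u).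
  rewrite (robust_impl (leqnn _) _ r) => [|s _ /andP[]//]; rewrite andbT.
  by have [s _ /andP[]] := robust_ex m'_gt0 r.
rewrite inE; have [aA|aA] := boolP (a \in A).
  by rewrite inE /= aA rl; move: au; rewrite aA => ->.
apply/orP; right; apply/imsetP; exists (u, a) => //; rewrite inE /= aA.
rewrite (negbTE aA) in au; rewrite -(eq_robust _ (fun s _ => linkC a u s)) rl andbT.
by move: au; case: (u \in A).
Qed.

(** A clique of order [t] that contains [y], followed by a vertex that can
replace [y] in it, gives a vertex linked to [y]. *)
Lemma robust_degree (y : H) m m' :
    (forall j, 0 < j < t -> m + j.+1 + 'C(j, k.-1) * D <= #|H|) ->
  m ^ t * #|H| <=
    #|[set z | robust m' t.-1 (link y z)]| * #|H| ^ t + #|H| * (t.-1 * m' * #|H| ^ t.-1).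
Proof.
move=> hV; have tE : t = t.-1 + 1 by rewrite addn1 prednK // ltnW.
pose P s := link y (nth y s t.-1) (take t.-1 s).
have rP : robust m (t.-1 + 1) P.
  have c1 : clique [set v in [:: y]].
    apply: clique_small; apply: leq_ltn_trans k_gt1.
    by rewrite cardsE (leq_trans (card_size _)).
  have h1 j : size [:: y] <= j < size [:: y] + t.-1 -> m + j + 'C(j, k.-1) * D <= #|[set: H]|.
    rewrite /= add1n prednK ?(ltnW t_gt1) // cardsT => hj.
    by apply: leq_trans (hV j hj); rewrite leq_add2r leq_add2l.
  have := @robust_clique (fun=> setT) m t.-1 [:: y] isT c1 h1; rewrite robust_cat.
  apply: robust_impl => // s st /and3P[]; rewrite cats1 rcons_uniq => /andP[ys us] cys _.
  have cs : clique [set v in s].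
    by apply: clique_sub cys; apply/subsetP => v; rewrite !inE mem_rcons inE orbC => ->.
  have h2 j : size s <= j < size s + 1 -> m + j + 'C(j, k.-1) * D <= #|~: [set y]|.
    rewrite st addn1 ltnS => /andP[j1 j2]; have -> : j = t.-1.
      by apply/eqP; rewrite eqn_leq j1 j2.
    have := hV t.-1; rewrite -subn1 subn_gt0 t_gt1 subn1 prednK ?(ltnW t_gt1) // leqnn => /(_ isT).
    have := cardsC1 y; have := t_gt1; set a := 'C(_, _) * D; clear; lia.
  have := @robust_clique (fun=> ~: [set y]) m 1 s us cs h2; apply: robust_impl => // -[|z []] //= _.
  move=> /and3P[/andP[zs _] cz /andP[]]; rewrite !inE => zy _; rewrite /P.
  rewrite nth_cat st ltnn subnn /= take_cat st ltnn subnn take0 cats0 /link /=.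
  rewrite in_cons negb_or eq_sym zy ys zs us cz andbT /=.
  suff <- : [set v in rcons s y] = [set v in y :: s] by rewrite cys.
  by apply/setP => v; rewrite !inE mem_rcons in_cons.
have cP : count_seq (t.-1 + 1) P = \sum_z count_seq t.-1 (link y z).
  rewrite count_seq_insert addn0; apply: eq_bigr => z _; apply: eq_count_seq => s st.
  rewrite /P take_oversize ?st // drop_oversize ?st //.
  by rewrite nth_cat st ltnn subnn take_cat st ltnn subnn take0 cats0.
have := robust_count rP; rewrite cP -tE => h.
apply: leq_trans (leq_mul h (leqnn _)) _.
by apply: leq_trans (count_fibers m' _ _) _; rewrite prednK ?(ltnW t_gt1).
Qed.

(** A step of a chain of connections: [Z] offers the choices for the middle
vertex, and avoiding what was chosen before costs a bounded number of choices. *)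
Lemma robust_swaps_trans (x y : H) (Z : {set H}) m h m1 m2 :
    (forall z, z \in Z -> robust m1 h (fun s => swaps s x z)) ->
    (forall z, z \in Z -> robust m2 t.-1 (link z y)) ->
    m + 2 <= #|Z| -> m + 1 <= m1 -> m + h.+1 <= m2 ->
  robust m (h + t) (fun s => swaps s x y).
Proof.
move=> h1 h2 mZ mm1 mm2.
have -> : h + t = 1 + (h + t.-1) by have := t_gt1; clear; lia.
rewrite robust_cat /=; apply: (@leq_trans #|Z :\: [set x; y]|).
  have := cardsD Z [set x; y]; have := subset_leq_card (subsetIr Z [set x; y]).
  by have := cards2 x y; move: mZ; case: (x != y) => /=; clear; lia.
apply: subset_leq_card; apply/subsetP => z; rewrite !inE negb_or => /andP[/andP[zx zy] zZ].
rewrite robust_cat; have := robust_avoid [set y] (h1 z zZ).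
apply: robust_impl => [|s1 s1h /andP[sw1 /allP ys1]].
  by rewrite cards1; move: mm1; clear; lia.
have := robust_avoid (x |: [set v in s1]) (h2 z zZ).
apply: robust_impl => [|s2 s2t /andP[l2 /allP xs2]].
  have : #|x |: [set v in s1]| <= h.+1.
    rewrite cardsU1 cardsE -add1n leq_add ?leq_b1 // -s1h; exact: card_size.
  by move: mm2; clear; lia.
apply: swaps_trans sw1 (link_swaps s2t l2).
- by rewrite eq_sym.
- rewrite inE negb_or eq_sym zy /=; apply/negP => /ys1; by rewrite /= !inE eqxx.
- by apply/negP => /xs2; rewrite /= !inE eqxx.
- by apply/allP => v /xs2; rewrite /= !inE negb_or => /andP[].
Qed.

Lemma robust_swaps_pad (x y : H) m h m1 :
    robust m1 h (fun s => swaps s x y) -> m <= m1 ->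
    (forall j, j < t -> m + j + h.+2 + 'C(j, k.-1) * D <= #|H|) ->
  robust m (h + t) (fun s => swaps s x y).
Proof.
move=> h1 mm1 hV; rewrite robust_cat; apply: robust_impl h1 => // s sh sw.
set F := x |: (y |: [set v in s]).
have cF : #|F| <= h.+2.
  rewrite /F !cardsU1 cardsE -sh -add1n -(add1n (size s)).
  by rewrite !leq_add ?leq_b1 ?card_size.
have c0 : clique [set v in ([::] : seq H)].
  by apply: clique_small; rewrite cardsE card0; apply: ltnW.
have hW j : 0 <= j < 0 + t -> m + j + 'C(j, k.-1) * D <= #|~: F|.
  rewrite add0n /= => /hV; have := cardsC F; rewrite -/#|H|.
  by move: cF; set a := 'C(_, _) * D; clear; lia.
have := @robust_clique (fun=> ~: F) m t [::] isT c0 hW.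
apply: robust_impl => // T Tt; rewrite cats0 => /and3P[uT cT WT].
apply: swaps_pad => //; apply/allP => v vT /=.
have := all_from_nth v (i := index v T) WT; rewrite index_mem => /(_ vT).
by rewrite nth_index // in_setC.
Qed.

End Connect.

(** * Any two vertices are connected *)

Lemma leq_mul_div K n : K <= n -> 0 < K -> n <= 2 * K * (n %/ K).
Proof.
move=> Kn K_gt0; have := ltn_ceil n K_gt0; have := divn_gt0 n K_gt0; rewrite Kn.
set d := n %/ K; move: d => d; rewrite mulnC [in X in _ -> X -> _]mulnC; clear; nia.
Qed.

Lemma divn_le_eps (R : realType) (c : R) : (0 < c)%R -> exists2 K, 0 < K & forall M, exists n0, forall n,
  n0 <= n -> ((n %/ K + M)%:R <= c * n%:R)%R.
Proof.
move=> c_gt0; pose K := (Num.bound (2 / c)).+1; exists K => // M.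
exists (Num.bound (2 * M%:R / c)) => n hn; rewrite natrD.
have cn : (2 * M%:R <= c * n%:R)%R.
  rewrite [leRHS]mulrC -ler_pdivrMr //; apply: le_trans (ltW (archi_boundP _)) _.
    by rewrite divr_ge0 ?mulr_ge0 // ltW.
  by rewrite ler_nat.
have Kc : (2 <= c * K%:R)%R.
  rewrite [leRHS]mulrC -ler_pdivrMr //; apply: le_trans (ltW (archi_boundP _)) _.
    by rewrite divr_ge0 // ltW.
  by rewrite ler_nat.
have dK : (2 * (n %/ K)%:R <= c * n%:R)%R.
  apply: (@le_trans _ _ (c * K%:R * (n %/ K)%:R)%R); first exact: ler_wpM2r.
  by rewrite -mulrA ler_wpM2l ?(ltW c_gt0) // -natrM ler_nat mulnC leq_divM.
by move: cn dK; lra.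
Qed.

Lemma divn_room n K K' M : 0 < K -> 2 * K <= K' -> K' * M <= n -> n %/ K' + M <= n %/ K.
Proof.
move=> K_gt0 KK' hM; rewrite leq_divRL // mulnDl.
have h1 : n %/ K' * (2 * K) <= n.
  by apply: leq_trans (leq_divM n K'); rewrite leq_mul2l KK' orbT.
have h2 : 2 * K * M <= n by apply: leq_trans hM; rewrite leq_mul2r KK' orbT.
by move: h1 h2; rewrite mulnCA -mulnA (mulnC K); set y := M * K; set z := _ * K; clear; lia.
Qed.

Definition small_nonnbr (R : realType) k (a : R) (H : kgraph k) : Prop :=
  forall S : {set H}, #|S| = k.-1 -> (#|nonnbr S|%:R <= a * #|H|%:R)%R.

(** With a proportion of non-neighbours below [alpha], cliques of order [t] can
be chosen with at least [q] vertices in one part of a cut and at least [p] in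
the other one, if that contains half of the vertices ([cross_half]; the first
[q < k] vertices are unrestricted).  They have at most [mu] of their
[k.-1]-subsets within a part, and [cross_two] bounds the total weight
in [many_crossing]. *)
Record crossing_cond (R : realType) k t (alpha : R) p q mu : Prop := CrossingCond {
  cross_p : 0 < p; cross_q : 0 < q < k; cross_pq : p + q <= t;
  cross_all : (alpha * 'C(t.-1, k.-1)%:R <= 1)%R;
  cross_half : (alpha * 'C((p + q).-1, k.-1)%:R <= 1 / 2)%R;
  cross_mono : forall a b, a + b = t -> p <= a -> q <= b -> 'C(a, k.-1) + 'C(b, k.-1) <= mu;
  cross_two : (alpha * ('C(t, k.-1) + mu)%:R <= 2)%R }.

Section Asymptotic.
Variables (R : realType) (k t : nat) (a alpha : R) (p q mu : nat).
Hypotheses (k_gt1 : 1 < k) (t_gt1 : 1 < t).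
Hypotheses (a_ge0 : (0 <= a)%R) (a_lt : (a < alpha)%R).
Hypothesis cc : crossing_cond k t alpha p q mu.

(* all the room that is needed comes from the relative distance of [a] and
   [alpha] *)
Let g : R := (1 - a / alpha)%R.

Let alpha_gt0 : (0 < alpha)%R.
Proof. exact: le_lt_trans a_lt. Qed.

Let g_gt0 : (0 < g)%R.
Proof. by rewrite subr_gt0 ltr_pdivrMr // mul1r. Qed.

Let aE : a = (alpha * (1 - g))%R.
Proof. by rewrite /g subKr mulrC divfK // lt0r_neq0. Qed.

Let g_le1 : (g <= 1)%R.
Proof. by rewrite gerBl divr_ge0 // ltW. Qed.

Lemma room (n D M C W : nat) (b : R) : (D%:R <= a * n%:R)%R -> (alpha * C%:R <= b)%R ->
  (M%:R <= g * b * n%:R)%R -> (b * n%:R <= W%:R)%R -> M + C * D <= W.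
Proof.
move=> hD hC hM hW; rewrite -(ler_nat R) natrD natrM.
apply: le_trans hW; have h1 : (C%:R * D%:R <= (1 - g) * b * n%:R)%R.
  apply: le_trans (ler_wpM2l (ler0n _ _) hD) _.
  rewrite aE mulrA; apply: ler_wpM2r => //.
  rewrite mulrA mulrC; apply: ler_wpM2l; first by rewrite subr_ge0.
  by rewrite mulrC.
by apply: le_trans (lerD hM h1) _; rewrite -mulrDl -mulrDl addrC subrK mul1r.
Qed.

Lemma small_nonnbr_nat (H : kgraph k) : small_nonnbr a H ->
  exists2 D, (D%:R <= a * #|H|%:R)%R & forall S : {set H}, #|S| = k.-1 -> #|nonnbr S| <= D.
Proof.
move=> hH; have aH : (0 <= a * #|H|%:R)%R by rewrite mulr_ge0.
exists (Num.truncn (a * #|H|%:R)%R); first by rewrite truncn_le.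
by move=> S Sk; rewrite truncn_ge_nat //; exact: hH.
Qed.

Lemma bin_room j : j < t -> (alpha * 'C(j, k.-1)%:R <= 1)%R.
Proof.
move=> jt; apply: le_trans (cross_all cc); rewrite ler_pM2l // ler_nat leq_bin2l //.
by rewrite -ltnS prednK // ltnW.
Qed.

(** [robust_degree] with [m] and [m'] fixed proportions of the number of
vertices; [m'] is so small that the non-robust pairs account for at most half of
the count. *)
Lemma linked_degree : exists K n0, 0 < K /\ forall (H : kgraph k), n0 <= #|H| ->
  small_nonnbr a H -> forall y : H,
  #|H| <= K * #|[set z | robust (#|H| %/ K) t.-1 (link y z)]|.
Proof.
have [K0 K0_gt0 hK0] := divn_le_eps g_gt0; have [n1 hn1] := hK0 t.
pose M := (2 * K0) ^ t; have M_gt0 : 0 < M by rewrite expn_gt0 muln_gt0 K0_gt0.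
have t_gt0 := ltnW t_gt1.
exists (2 * M * t), (maxn 1 (maxn n1 K0)); split; first by rewrite !muln_gt0 M_gt0 t_gt0.
move=> H; set n := #|H|; rewrite !geq_max => /and3P[n_gt0 nn1 nK0] hH y.
have [D Dn hD] := small_nonnbr_nat hH.
set m' := n %/ _; set d := #|_|.
have room_all j : 0 < j < t -> n %/ K0 + j.+1 + 'C(j, k.-1) * D <= n.
  move=> /andP[_ jt]; apply: (room Dn (bin_room jt)); rewrite ?mul1r // mulr1.
  by apply: le_trans (hn1 n nn1); rewrite ler_nat leq_add2l.
have := @robust_degree k H D k_gt1 hD t t_gt1 y (n %/ K0) m' room_all.
rewrite -/d -/n => h.
have hm : n ^ t <= M * (n %/ K0) ^ t.
  by rewrite -expnMn leq_exp2r // leq_mul_div.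
have hm' : m' * (2 * M * t) <= n by rewrite leq_divM.
have tE : t = t.-1.+1 by rewrite prednK.
have hn : n ^ t * n <= (M * (d + t.-1 * m')) * n ^ t.
  apply: leq_trans (leq_mul hm (leqnn n)) _; rewrite -!mulnA leq_mul2l; apply/orP; right.
  apply: leq_trans h _; rewrite mulnDl leq_add2l mulnCA leq_eqVlt; apply/orP; left; apply/eqP.
  by rewrite {4}tE expnS.
have {}hn : n <= M * (d + t.-1 * m').
  by move: hn; rewrite mulnC leq_pmul2r // expn_gt0 n_gt0.
have : 2 * (M * (t.-1 * m')) <= n.
  apply: leq_trans hm'; rewrite (mulnC m') -!mulnA leq_mul2l /= leq_mul2l leq_mul2r.
  by rewrite leq_pred !orbT.
move: hn; rewrite mulnDr => hn hm2.
have : n <= 2 * M * d by move: hn hm2; rewrite -mulnA; set u := M * d; set v := M * _; clear; lia.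
by move=> /leq_trans; apply; rewrite leq_mul2r leq_pmulr ?orbT.
Qed.

Let link_pairs (H : kgraph k) K (A : {set H}) :=
  [set e : H * H | [&& e.1 \in A, e.2 \notin A & robust (#|H| %/ K) t.-1 (link e.1 e.2)]].

(** The roles of [A] and [~: A] are exchanged, if necessary, so that [A] contains
at least half of the vertices. *)
Lemma linked_cut K4 : 0 < K4 -> exists K n0, 0 < K /\ forall (H : kgraph k), n0 <= #|H| ->
  small_nonnbr a H -> forall A : {set H}, #|H| <= K4 * #|A| -> #|H| <= K4 * #|~: A| ->
  #|H| ^ 2 <= K * #|[set e : H * H | [&& e.1 \in A, e.2 \notin A &
                      robust (#|H| %/ K) t.-1 (link e.1 e.2)]]|.
Proof.
move=> K4_gt0; have c_gt0 : (0 < g / (2 * K4%:R))%R by rewrite divr_gt0 ?mulr_gt0 ?ltr0n.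
have [K0 K0_gt0 hK0] := divn_le_eps c_gt0; have [n1 hn1] := hK0 t.
pose M := (2 * K0) ^ t.+1; have M_gt0 : 0 < M by rewrite expn_gt0 muln_gt0 K0_gt0.
have t_gt0 := ltnW t_gt1.
pose K := 4 * M * t * t.
exists K, (maxn n1 (maxn K K0)); split; first by rewrite !muln_gt0 M_gt0 t_gt0.
move=> H; set n := #|H|; rewrite !geq_max => /and3P[nn1 nK nK0] hH.
have K_gt0 : 0 < K by rewrite !muln_gt0 M_gt0 t_gt0.
have n_gt0 : 0 < n by apply: leq_trans nK.
have m'_gt0 : 0 < n %/ K by rewrite divn_gt0.
have [D Dn hD] := small_nonnbr_nat hH.
have small : ((n %/ K0 + t)%:R <= g / (2 * K4%:R) * n%:R)%R by apply: hn1.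
have small1 : ((n %/ K0 + t)%:R <= g * (1 / 2) * n%:R)%R.
  apply: le_trans small _; rewrite ler_wpM2r // ler_wpM2l ?(ltW g_gt0) //.
  by rewrite mul1r lef_pV2 ?posrE ?mulr_gt0 ?ltr0n // ler_peMr // ler1n.
have small2 : ((n %/ K0 + t)%:R <= g * n%:R)%R.
  by apply: (le_trans small1); rewrite ler_wpM2r // ler_piMr ?(ltW g_gt0) //; lra.
suff large (A : {set H}) : n <= 2 * #|A| -> n <= K4 * #|~: A| -> n ^ 2 <= K * #|link_pairs K A|.
  move=> A An Bn; have [hA|hA] := leqP n (2 * #|A|); first exact: large.
  have hB : n <= 2 * #|~: A| by have := cardsC A; rewrite -/n; move: hA; clear; lia.
  have := large (~: A) hB; rewrite setCK => /(_ An) /leq_trans; apply.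
  rewrite leq_mul2l; apply/orP; right.
  apply: leq_trans (leq_imset_card (fun e : H * H => (e.2, e.1)) _).
  apply: subset_leq_card; apply/subsetP => -[u v]; rewrite !inE /= negbK => /and3P[uA vA rl].
  apply/imsetP; exists (v, u) => //; rewrite !inE /= uA vA.
  by rewrite (eq_robust _ (fun s _ => linkC v u s)).
move=> An Bn.
set m' := n %/ K in m'_gt0 *; set P := #|_|.
have /card_gt0P[x0 _] : 0 < #|H| by [].
have [q_gt0 qk] := andP (cross_q cc).
have roomB j : j < q -> n %/ K0 + j + 'C(j, k.-1) * D <= #|~: A|.
  move=> jq; rewrite bin_small ?mul0n ?addn0; last by move: jq qk; clear; lia.
  have jt : j <= t by apply: ltnW (leq_trans jq (leq_trans (leq_addl _ _) (cross_pq cc))).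
  apply: (@leq_trans (n %/ K0 + t)); first by rewrite leq_add2l.
  rewrite -(ler_nat R); apply: (le_trans small).
  have Bn' : (n%:R <= K4%:R * #|~: A|%:R :> R)%R by rewrite -natrM ler_nat.
  have K4R : (0 < K4%:R :> R)%R by rewrite ltr0n.
  apply: (@le_trans _ _ (K4%:R^-1 * n%:R)%R); last by rewrite mulrC ler_pdivrMr // mulrC.
  apply: ler_wpM2r => //; rewrite -[leRHS]mul1r; apply: ler_pM => //; first exact: ltW.
    by rewrite invr_ge0 mulr_ge0.
  by rewrite lef_pV2 ?posrE ?mulr_gt0 // ler_peMl ?ler1n // ltW.
have roomA j : q <= j < p + q -> n %/ K0 + j + 'C(j, k.-1) * D <= #|A|.
  move=> /andP[_ jpq]; apply: (@room n D _ _ _ (1 / 2)) => //.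
  - apply: le_trans (cross_half cc); rewrite ler_pM2l // ler_nat leq_bin2l //.
    by move: jpq; clear; lia.
  - apply: le_trans small1; rewrite ler_nat leq_add2l.
    by apply: leq_trans (cross_pq cc); apply: ltnW.
  - have : (n%:R <= 2%:R * #|A|%:R :> R)%R by rewrite -natrM ler_nat.
    lra.
have roomV j : p + q <= j < t -> n %/ K0 + j + 'C(j, k.-1) * D <= n.
  move=> /andP[_ jt]; apply: (room Dn (bin_room jt)); rewrite ?mul1r // mulr1.
  by apply: le_trans small2; rewrite ler_nat leq_add2l ltnW.
have room2 : 2 * (n %/ K0 + t) + ('C(t, k.-1) + mu) * D <= 2 * n.
  apply: (@room n D _ _ _ 2) => //; first exact: cross_two cc.
    by rewrite natrM (mulrC g) -mulrA ler_pM2l.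
  by rewrite -natrM.
have := robust_cut k_gt1 hD t_gt1 x0 (cross_p cc) q_gt0 (cross_pq cc) roomB roomA roomV room2 (cross_mono cc) m'_gt0.
rewrite -/n -/P => h.
have hm : n ^ t.+1 <= M * (n %/ K0) ^ t.+1.
  by rewrite -expnMn leq_exp2r // leq_mul_div.
have hm' : m' * K <= n by rewrite leq_divM.
have tE : t = t.-1.+1 by rewrite prednK.
set u := n %/ K0 in hm h *.
have h1 : n ^ t.+1 * n <= M * (t * (2 * P * n ^ t + n ^ 2 * (t.-1 * m' * n ^ t.-1))).
  by apply: leq_trans (leq_mul hm (leqnn n)) _; rewrite -mulnA leq_mul2l h orbT.
have E1 : n ^ t.+1 * n = n ^ 2 * n ^ t by rewrite -expnSr -expnD.
have E2 : n ^ 2 * (t.-1 * m' * n ^ t.-1) = (t.-1 * m') * n * n ^ t.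
  have -> : n ^ t = n * n ^ t.-1 by rewrite {1}tE expnS.
  by move: (n ^ t.-1) (t.-1) => y z; rewrite -mulnn; ring.
rewrite E1 E2 in h1.
have nt_gt0 : 0 < n ^ t by rewrite expn_gt0 n_gt0.
have h2 : n ^ 2 <= M * t * (2 * P + t.-1 * m' * n).
  rewrite -(leq_pmul2r nt_gt0); apply: leq_trans h1 _; rewrite leq_eqVlt; apply/orP; left.
  by apply/eqP; move: (n ^ t) (t.-1) => y z; ring.
have h3 : M * t * (t.-1 * m' * n) * 2 <= n ^ 2.
  rewrite (_ : _ * 2 = (M * t * t.-1 * 2 * m') * n); last by ring.
  rewrite -mulnn leq_mul2r; apply/orP; right; apply: leq_trans hm'.
  rewrite mulnC leq_mul2l; apply/orP; right; rewrite /K.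
  rewrite (_ : 4 * M * t * t = M * t * t * 4); last by ring.
  by rewrite leq_mul // leq_mul2l leq_pred orbT.
have : n ^ 2 <= 4 * (M * t * P).
  by move: h2 h3; rewrite mulnDr; set v := M * t * (_ * n); set w := M * t; clear; lia.
move=> /leq_trans; apply; rewrite /K -!mulnA leq_mul2l /= leq_mul2l; apply/orP; right.
by rewrite leq_mul2l leq_pmull ?orbT.
Qed.

(** As long as its complement is not small, the set [A] of vertices connected to
[x] is a side of a cut with many linked pairs; hence a fixed proportion of the
vertices has many links to [A], and these are connected to [x] in one more step.
The vertices of [A] are kept by padding their connections with cliques.  When
the complement is small, every vertex [y] has most of its links in [A]. *)
Lemma grow_connected : exists KA, 0 < KA /\ (exists K5, 0 < K5 /\ forall j,
  exists K h n0, 0 < K /\ forall (H : kgraph k), n0 <= #|H| -> small_nonnbr a H ->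
  forall x : H, exists A : {set H},
    (forall y, y \in A -> robust (#|H| %/ K) h (fun s => swaps t s x y)) /\
    (KA * #|~: A| < #|H| \/ #|H| * j <= K5 * #|A|)) /\
  exists K n0, 0 < K /\ forall (H : kgraph k), n0 <= #|H| -> small_nonnbr a H ->
  forall (A : {set H}) (y : H), KA * #|~: A| < #|H| ->
    #|H| <= K * #|[set z in A | robust (#|H| %/ K) t.-1 (link z y)]|.
Proof.
have [K1 [n1 [K1_gt0 hdeg]]] := linked_degree.
have K1_2 : 0 < 2 * K1 by rewrite muln_gt0.
have [K6 [n6 [K6_gt0 hcut]]] := linked_cut K1_2.
exists (2 * K1); split; [by rewrite muln_gt0|split].
- exists (2 * K6); split; first by rewrite muln_gt0.
  suff main j : exists K h n0, 0 < K /\ forall (H : kgraph k), n0 <= #|H| -> small_nonnbr a H ->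
      forall x : H, exists A : {set H},
      (forall y, y \in A -> robust (#|H| %/ K) h (fun s => swaps t s x y)) /\
      (#|H| <= K1 * #|A| /\ (2 * K1 * #|~: A| < #|H| \/ #|H| * j <= 2 * K6 * #|A|)).
    move=> j; have [K [h [n0 [K_gt0 hK]]]] := main j; exists K, h, n0; split => // H Hn hH x.
    by have [A [A1 [A2 A3]]] := hK H Hn hH x; exists A.
  elim: j => [|j [K [h [n0 [K_gt0 IH]]]]].
    exists K1, t.-1, n1; split => // H Hn hH x.
    exists [set z | robust (#|H| %/ K1) t.-1 (link x z)]; split; last first.
      by split; [exact: hdeg|right; rewrite muln0].
    move=> y; rewrite inE; apply: robust_impl => // s st; exact: link_swaps.
  have [K0 K0_gt0 hK0] := divn_le_eps g_gt0; have [n2 hn2] := hK0 (t + h.+2).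
  pose K' := 2 * (K + 2 * K6) + K0.
  exists K', (h + t), (maxn (maxn n0 n6) (maxn n2 (maxn 1 (K' * h.+2)))); split.
    by rewrite addn_gt0 K0_gt0 orbT.
  move=> H; rewrite !geq_max => /andP[/andP[Hn0 Hn6] /and3P[Hn2 H_gt0 HnK']] hH x.
  have [A [hA [An hA2]]] := IH H Hn0 hH x.
  have K'K : 2 * K <= K' by rewrite /K'; clear; lia.
  have K'K6 : 2 * (2 * K6) <= K' by rewrite /K'; clear; lia.
  have room1 := divn_room K_gt0 K'K HnK'.
  have K62_gt0 : 0 < 2 * K6 by rewrite muln_gt0.
  have room2 := divn_room K62_gt0 K'K6 HnK'.
  have pad y : y \in A -> robust (#|H| %/ K') (h + t) (fun s => swaps t s x y).
    have [D Dn hD] := small_nonnbr_nat hH.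
    move=> yA; apply: (robust_swaps_pad k_gt1 hD t_gt1 (hA y yA)) => [|j' j't].
      by apply: leq_trans room1; rewrite leq_addr.
    apply: (room Dn (bin_room j't)); rewrite ?mul1r // mulr1.
    apply: le_trans (hn2 _ Hn2); rewrite ler_nat -addnA.
    apply: leq_add; last by rewrite leq_add2r ltnW.
    by apply: leq_div2l => //; rewrite /K' leq_addl.
  have [hs|hs] := leqP #|H| (2 * K1 * #|~: A|); last first.
    exists A; split; first exact: pad.
    by split => //; left.
  have {hA2} hj : #|H| * j <= 2 * K6 * #|A| by case: hA2 => //; rewrite ltnNge hs.
  have An' : #|H| <= 2 * K1 * #|A| by apply: (leq_trans An); rewrite leq_mul2r leq_pmull ?orbT.
  have := hcut H Hn6 hH A An' hs.
  set n := #|H| in H_gt0 room1 room2 pad hs hj An An' *; set P := #|_| => hP.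
  pose Z u := [set z in A | robust (n %/ K6) t.-1 (link z u)].
  pose G := [set u in ~: A | n %/ (2 * K6) <= #|Z u|].
  have PE : P = \sum_(u in ~: A) #|Z u|.
    rewrite /P; set E := [set e : H * H | _].
    have -> : #|E| = \sum_z \sum_u ((z, u) \in E).
      by rewrite pair_bigA card_sum_mem; apply: eq_bigr => -[].
    rewrite exchange_big /=.
    rewrite [RHS]big_mkcond /=; apply: eq_bigr => u _; rewrite in_setC.
    case: ifPn => uA; last first.
      by rewrite big1 // => z _; rewrite inE /= (negbTE uA) andbF.
    rewrite card_sum_mem; apply: eq_bigr => z _; by rewrite !inE /= uA.
  have hG : n <= 2 * K6 * #|G|.
    set w := n %/ (2 * K6) in G room2 *.
    have PG : P <= #|G| * n + n * w.
      rewrite PE (@leq_trans (\sum_(u : H) ((u \in G) * n + w))) //.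
        rewrite big_mkcond; apply: leq_sum => u _; case: ifPn => // uA.
        case: (boolP (u \in G)) => [_|]; first by rewrite mul1n (leq_trans (max_card _)) ?leq_addr.
        by rewrite inE uA /= -ltnNge => /ltnW.
      by rewrite big_split /= -big_distrl /= -card_sum_mem sum_nat_const.
    have h2 : w * (2 * K6) <= n by exact: leq_divM.
    have : n * n <= (2 * K6 * #|G|) * n.
      have h1 : n * n <= K6 * (#|G| * n + n * w).
        by rewrite mulnn (leq_trans hP) // leq_mul2l PG orbT.
      have h3 : 2 * (K6 * (n * w)) <= n * n.
        by rewrite (_ : 2 * _ = n * (w * (2 * K6))); [rewrite leq_mul2l h2 orbT|ring].
      have E1 : 2 * K6 * #|G| * n = 2 * (K6 * (#|G| * n)) by rewrite !mulnA.
      by move: h1 h3; rewrite E1 mulnDr; clear; lia.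
    by rewrite leq_pmul2r.
  have [D Dn hD] := small_nonnbr_nat hH.
  exists (A :|: G); split.
    move=> y; rewrite in_setU => /orP[/pad//|]; rewrite inE => /andP[yA yZ].
    apply: (robust_swaps_trans t_gt1 (Z := Z y) (m1 := n %/ K) (m2 := n %/ K6)).
    + by move=> z; rewrite inE => /andP[zA _]; exact: hA.
    + by move=> z; rewrite inE => /andP[].
    + by apply: leq_trans yZ; apply: leq_trans room2; rewrite leq_add2l.
    + by apply: leq_trans room1; rewrite leq_add2l.
    + apply: leq_trans (leq_trans room2 _); first by rewrite leq_add2l.
      by apply: leq_div2l => //; rewrite leq_pmull.
  split; first by apply: (leq_trans An); rewrite leq_mul2l subset_leq_card ?orbT // subsetUl.
  right; rewrite mulnS cardsU (_ : A :&: G = set0) ?cards0 ?subn0.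
    by rewrite mulnDr addnC leq_add.
  by apply/setP => u; rewrite !inE; case: (u \in A).
- exists (2 * K1), n1; split; first by rewrite muln_gt0.
  move=> H Hn hH A y hA; set n := #|H|; set Z := [set z in A | _].
  pose L := [set z | robust (n %/ K1) t.-1 (link y z)].
  have dL : n <= K1 * #|L| by exact: hdeg.
  have LZ : #|L| <= #|Z| + #|~: A|.
    apply: leq_trans (leq_card_setU _ _).1; apply: subset_leq_card; apply/subsetP => z.
    rewrite !inE => rl; case: (z \in A) => //=; rewrite orbF.
    rewrite (eq_robust _ (fun s _ => linkC z y s)); apply: robust_impl rl => //.
    by apply: leq_div2l => //; rewrite leq_pmull.
  have := leq_trans dL (leq_mul (leqnn K1) LZ); rewrite mulnDr.
  by move: hA; rewrite -/n -!mulnA; set v := K1 * #|Z|; set w := K1 * _; clear; lia.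
Qed.

Theorem connected : exists K h n0, 0 < K /\ forall (H : kgraph k), n0 <= #|H| ->
  small_nonnbr a H -> forall x y : H, robust (#|H| %/ K) h (fun s => swaps t s x y).
Proof.
have [KA [KA_gt0 [[K5 [K5_gt0 grow]] [K2 [n2 [K2_gt0 hK2]]]]]] := grow_connected.
have [K [h [n0 [K_gt0 hK]]]] := grow K5.
pose K' := 2 * (K + K2).
exists K', (h + t), (maxn (maxn n0 n2) (maxn 1 (K' * h.+2))); split.
  by rewrite muln_gt0 addn_gt0 K_gt0.
move=> H; rewrite !geq_max => /andP[/andP[Hn0 Hn2] /andP[H_gt0 HnK']] hH x y.
have [A [hA hA2]] := hK H Hn0 hH x.
have As : KA * #|~: A| < #|H|.
  case: hA2 => // hA2; suff -> : #|~: A| = 0 by rewrite muln0.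
  move: hA2; rewrite mulnC leq_pmul2l // => nA.
  by have := cardsC A; move: nA; clear; lia.
have K'K : 2 * K <= K' by rewrite /K'; clear; lia.
have K'K2 : 2 * K2 <= K' by rewrite /K'; clear; lia.
have room1 := divn_room K_gt0 K'K HnK'.
have room2 := divn_room K2_gt0 K'K2 HnK'.
have hZ := hK2 H Hn2 hH A y As.
apply: (robust_swaps_trans t_gt1 (Z := [set z in A | robust (#|H| %/ K2) t.-1 (link z y)])
  (m1 := #|H| %/ K) (m2 := #|H| %/ K2)).
- by move=> z; rewrite inE => /andP[zA _]; exact: hA.
- by move=> z; rewrite inE => /andP[].
- apply: (@leq_trans (#|H| %/ K2)); first by apply: leq_trans room2; rewrite leq_add2l.
  by rewrite -(leq_pmul2l K2_gt0) (leq_trans _ hZ) // mulnC leq_divM.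
- by apply: leq_trans room1; rewrite leq_add2l.
- by apply: leq_trans room2; rewrite leq_add2l.
Qed.

End Asymptotic.


(** * Almost perfect tilings *)
Local Open Scope ring_scope.

Lemma expR_le_quad (R : realType) (z : R) :
  `|z| <= 1 / 2 -> expR z <= 1 + z + 2 * z ^+ 2.
Proof.
rewrite ler_norml => /andP[z1 z2].
have h1 : 1 - z <= expR (- z) by exact: expR_ge1Dx.
have h0 : 0 < 1 - z by lra.
have h2 : expR z <= (1 - z)^-1 by rewrite -[z]opprK expRN opprK lef_pV2 ?posrE ?expR_gt0.
apply: (le_trans h2); rewrite -[leLHS]mul1r ler_pdivrMr //.
have -> : (1 + z + 2 * z ^+ 2) * (1 - z) = 1 + z ^+ 2 * (1 - 2 * z) by ring.
by rewrite lerDl mulr_ge0 ?sqr_ge0 //; lra.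
Qed.

Lemma natX_le_expR (R : realType) (x : nat) (c : R) : 0 < c ->
  exists n0 : nat, forall n : nat, (n0 <= n)%N -> n%:R ^+ x <= expR (c * n%:R).
Proof.
move=> c_gt0; pose d := c / x.+1%:R.
have d_gt0 : 0 < d by rewrite divr_gt0.
exists (Num.bound (d^-1 ^+ x.+1)) => n hn.
have n_ge : d^-1 ^+ x.+1 <= n%:R.
  apply: le_trans (ltW (archi_boundP _)) _; last by rewrite ler_nat.
  by rewrite exprn_ge0 // invr_ge0 ltW.
have -> : c * n%:R = d * n%:R * x.+1%:R.
  by rewrite [RHS]mulrAC /d divfK ?pnatr_eq0.
rewrite expRM_natr.
apply: (@le_trans _ _ ((d * n%:R) ^+ x.+1)); last first.
  have dn : 0 <= d * n%:R by rewrite mulr_ge0 // ltW.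
  rewrite lerXn2r ?nnegrE ?expR_ge0 //.
  by apply: le_trans _ (expR_ge1Dx _); rewrite lerDr.
rewrite exprMn [n%:R ^+ x.+1]exprSr mulrCA -[leLHS]mulr1 ler_wpM2l ?exprn_ge0 //.
rewrite mulrC -ler_pdivrMr ?exprn_gt0 // mul1r -exprVn //.
Qed.

Lemma bin_le_exp n m : ('C(n, m) <= n ^ m)%N.
Proof.
elim: m n => [|m IH] n; first by rewrite bin0.
rewrite (@leq_trans (m.+1 * 'C(n, m.+1))) ?leq_pmull // -mul_bin_diag expnS leq_mul2l.
rewrite (leq_trans (IH _)) ?orbT //; case: (posnP m) => [->//|m_gt0].
by rewrite leq_exp2r // leq_pred.
Qed.

Definition has_light_cliques (R : realType) k t (a : R) : Prop :=
  exists N0 : nat, forall (H : kgraph k) (U : {set H}) (N : nat),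
    (N0 <= N)%N -> #|U| = (t * N)%N ->
    (forall S : {set H}, S \subset U -> #|S| = k.-1 ->
       #|U :&: nonnbr S|%:R <= a * #|U|%:R) ->
  forall c : H -> R, light_clique U c t N.

Section AlmostTiling.
Variables (R : realType) (k t : nat) (a0 a1 eps : R).
Hypotheses (t_gt0 : (0 < t)%N).
Hypotheses (a0_ge0 : 0 <= a0) (a01 : a0 < a1) (a1_le1 : a1 <= 1) (eps_gt0 : 0 < eps) (eps_le1 : eps <= 1).

(* [lam * n] is the rate in the potential; it is linear in [n] to beat the
   polynomial number of [k.-1]-sets, and small enough for the quadratic error
   [kap * n] accumulated over all removals to cost only half of [a1 - a0] *)
Let lam : R := (a1 - a0) * eps ^+ 2 / (16 * t%:R).
Let kap : R := 8 * lam ^+ 2 * t%:R / eps ^+ 2.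

(** Removing [t] of [u] vertices, [c i] of which are counted by [u * x i],
changes a proportion [x i] by [(t * x i - c i) / (u - t)].  The linear term of
the potential does not increase by hypothesis, and the quadratic term is bounded
by [kap * t]. *)
Lemma removal_growth (I : finType) (P : pred I) (x : I -> R) (c : I -> nat) (u n : nat) :
    (t < u)%N -> eps * n%:R <= u%:R -> (2 * t <= u)%N -> (u <= n)%N ->
    (forall i, P i -> 0 <= x i <= 1) -> (forall i, P i -> (c i <= t)%N) ->
    t%:R * \sum_(i | P i) expR (lam * n%:R * x i) * x i
      <= \sum_(i | P i) expR (lam * n%:R * x i) * (c i)%:R ->
  \sum_(i | P i) expR (lam * n%:R * ((u%:R * x i - (c i)%:R) / (u - t)%:R))
   <= expR (kap * t%:R) * \sum_(i | P i) expR (lam * n%:R * x i).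
Proof.
move=> tu un tu2 u_le x01 ct h.
have t0 : 0 < t%:R :> R by rewrite ltr0n.
have n_gt0 : 0 < n%:R :> R by rewrite ltr0n; move: tu u_le; clear; lia.
have t2 : 2 * t%:R <= u%:R :> R by rewrite -(natrM _ 2 t) ler_nat.
have ut : (u - t)%:R = u%:R - t%:R :> R by rewrite natrB // ltnW.
have ut_gt0 : 0 < (u - t)%:R :> R by rewrite ltr0n subn_gt0.
have lam_gt0 : 0 < lam.
  by rewrite /lam divr_gt0 ?mulr_gt0 ?subr_gt0 ?exprn_gt0 ?ltr0n.
pose z i := lam * n%:R * ((t%:R * x i - (c i)%:R) / (u - t)%:R).
have zb i : P i -> `|z i| <= 2 * lam * t%:R / eps.
  move=> Pi; have /andP[x0 x1] := x01 i Pi.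
  have c1 : (c i)%:R <= t%:R :> R by rewrite ler_nat ct.
  have c0 : 0 <= (c i)%:R :> R by [].
  have wt : `|t%:R * x i - (c i)%:R| <= t%:R.
    have tx0 : 0 <= t%:R * x i by rewrite mulr_ge0 // ltW.
    have tx1 : t%:R * x i <= t%:R by rewrite -[leRHS]mulr1 ler_pM2l.
    by rewrite ler_norml; lra.
  have A0 : 0 <= lam * n%:R by rewrite mulr_ge0 // ltW.
  rewrite /z normrM (ger0_norm A0) normrM normfV (gtr0_norm ut_gt0) mulrA.
  rewrite ler_pdivrMr //; apply: le_trans (ler_wpM2l A0 wt) _.
  have d2 : eps * n%:R <= 2 * (u - t)%:R.
    by apply: (le_trans un); rewrite ut; lra.
  rewrite -subr_ge0; have -> : 2 * lam * t%:R / eps * (u - t)%:R - lam * n%:R * t%:R =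
     lam * t%:R / eps * (2 * (u - t)%:R - eps * n%:R).
    by field; rewrite lt0r_neq0.
  apply: mulr_ge0; last by rewrite subr_ge0.
  by apply: divr_ge0; [apply: mulr_ge0|]; exact: ltW.
have small : 2 * lam * t%:R / eps <= 1 / 2.
  have -> : 2 * lam * t%:R / eps = (a1 - a0) * eps / 8.
    by rewrite /lam; field; rewrite !lt0r_neq0.
  have : (a1 - a0) * eps <= 1 * 1.
    have d0 : 0 <= a1 - a0 by rewrite subr_ge0 ltW.
    have d1 : a1 - a0 <= 1 by rewrite lerBlDr ler_wpDr.
    exact: ler_pM d0 (ltW eps_gt0) d1 eps_le1.
  lra.
have step i : P i -> expR (lam * n%:R * ((u%:R * x i - (c i)%:R) / (u - t)%:R))
    <= expR (lam * n%:R * x i) * (1 + kap * t%:R) + expR (lam * n%:R * x i) * z i.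
  move=> Pi; have -> : lam * n%:R * ((u%:R * x i - (c i)%:R) / (u - t)%:R) =
      lam * n%:R * x i + z i.
    rewrite /z; have -> : u%:R = (u - t)%:R + t%:R :> R by rewrite ut subrK.
    by field; rewrite lt0r_neq0.
  rewrite expRD -mulrDr ler_wpM2l ?expR_ge0 //.
  apply: le_trans (expR_le_quad (le_trans (zb i Pi) small)) _.
  rewrite addrAC lerD2r lerD2l.
  have -> : kap * t%:R = 2 * (2 * lam * t%:R / eps) ^+ 2.
    by rewrite /kap; field; rewrite lt0r_neq0.
  rewrite ler_wpM2l // -(real_normK (num_real (z i))) lerXn2r ?nnegrE //; last exact: zb.
  by apply: divr_ge0; [apply: mulr_ge0; [apply: mulr_ge0|]|]; rewrite ?ltW.
apply: le_trans (ler_sum _ step) _.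
rewrite big_split /= -big_distrl /=.
apply: (@le_trans _ _ ((\sum_(i | P i) expR (lam * n%:R * x i)) * (1 + kap * t%:R))).
  rewrite gerDl.
  have -> : \sum_(i | P i) expR (lam * n%:R * x i) * z i =
      lam * n%:R / (u - t)%:R * (t%:R * \sum_(i | P i) expR (lam * n%:R * x i) * x i
      - \sum_(i | P i) expR (lam * n%:R * x i) * (c i)%:R).
    rewrite mulr_sumr -sumrB mulr_sumr; apply: eq_bigr => i _.
    by rewrite /z; field; rewrite lt0r_neq0.
  apply: mulr_ge0_le0; last by rewrite subr_le0.
  by apply: divr_ge0; [apply: mulr_ge0|]; rewrite ?ltW.
by rewrite mulrC ler_wpM2r ?sumr_ge0 ?expR_ge1Dx // => i _; exact: expR_ge0.
Qed.

Hypothesis light : has_light_cliques k t a1.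

(** The potential sums [expR (lam * n * (relative non-degree in U))] over all
[k.-1]-sets.  Each removed clique is one that [has_light_cliques] provides for
the cost of minus the total weight of the sets that a vertex does not extend, so
it contains its fair share of non-neighbours, on weighted average.  As long as
[U] has at least [eps * n] vertices, the potential bounds every relative
non-degree by [a1], and the removal can go on. *)
Lemma almost_tiling : exists n0 : nat, forall (H : kgraph k) (U0 : {set H}),
    (n0 <= #|U0|)%N -> (t %| #|U0|)%N ->
    (forall S : {set H}, S \subset U0 -> #|S| = k.-1 ->
       #|U0 :&: nonnbr S|%:R <= a0 * #|U0|%:R) ->
  exists U : {set H}, [/\ U \subset U0, #|U|%:R <= eps * #|U0|%:R & tileable t (U0 :\: U)].
Proof.
have [N0 hN0] := light.
have t0 : 0 < t%:R :> R by rewrite ltr0n.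
have lam_gt0 : 0 < lam.
  by rewrite /lam divr_gt0 ?mulr_gt0 ?subr_gt0 ?exprn_gt0 ?ltr0n.
have kapE : kap = lam * ((a1 - a0) / 2).
  by rewrite /kap /lam; field; rewrite !lt0r_neq0.
have kap_gt0 : 0 < kap by rewrite kapE; apply: mulr_gt0 => //; apply: divr_gt0; rewrite ?subr_gt0.
have [n1 hn1] := natX_le_expR k.-1 kap_gt0.
pose n2 := Num.bound ((t * N0 + 2 * t)%:R / eps).
exists (maxn 1 (maxn n1 n2)) => H U0 hn dvd_n hU0.
set n := #|U0| in hn dvd_n hU0 *.
have [n_gt0 nn1 nn2] : [/\ (0 < n)%N, (n1 <= n)%N & (n2 <= n)%N].
  by move: hn; rewrite !geq_max => /and3P[].
have eps_n : (t * N0 + 2 * t)%:R <= eps * n%:R :> R.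
  rewrite mulrC -ler_pdivrMr //; apply: le_trans (ltW (archi_boundP _)) _.
    by rewrite divr_ge0 // ltW.
  by rewrite ler_nat.
have n0R : 0 < n%:R :> R by rewrite ltr0n.
pose w (U S : {set H}) : R := expR (lam * n%:R * (#|U :&: nonnbr S|%:R / #|U|%:R)).
pose X := fun S : {set H} => (S \subset U0) && (#|S| == k.-1).
pose Psi (U : {set H}) : R := \sum_(S | X S) w U S.
have Psi0 : Psi U0 <= expR (kap * n%:R) * expR (lam * n%:R * a0).
  apply: (@le_trans _ _ (\sum_(S | X S) expR (lam * n%:R * a0))).
    apply: ler_sum => S /andP[SU /eqP Sk].
    rewrite /w ler_expR; apply: ler_wpM2l; first by rewrite mulr_ge0 // ltW.
    by rewrite ler_pdivrMr // hU0.
  rewrite sumr_const -[leLHS]mulr_natl ler_wpM2r ?expR_ge0 //.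
  apply: le_trans (hn1 n nn1); rewrite -natrX ler_nat.
  apply: leq_trans (bin_le_exp _ _); rewrite -cards_draws.
  by apply: subset_leq_card; apply/subsetP => S; rewrite !inE.
pose good (U : {set H}) := [/\ U \subset U0, tileable t (U0 :\: U) &
  Psi U * expR (kap * #|U|%:R) <= Psi U0 * expR (kap * n%:R)].
(* the second factor makes the invariant monotone: by [removal_growth] a removal
   multiplies the potential by at most [expR (kap * t)] *)
suff main m (U : {set H}) : (#|U| <= m)%N -> good U ->
    exists U : {set H}, [/\ U \subset U0, #|U|%:R <= eps * n%:R & tileable t (U0 :\: U)].
  apply: (main n U0) => //; split=> //; rewrite setDv; exact: tileable0.
elim: m U => [|m IH] U Um [UU0 tU hU].
  by exists U; split=> //; move: Um; rewrite leqn0 => /eqP->; rewrite mulr_ge0 // ltW.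
have [|u_gt] := leP #|U|%:R (eps * n%:R); first by exists U.
set u := #|U| in Um u_gt hU.
have u_big : (t * N0 + 2 * t < u)%N.
  by rewrite -(ltr_nat R) (le_lt_trans eps_n).
have u_le : (u <= n)%N by exact: subset_leq_card.
have u_gt0 : (0 < u)%N by apply: leq_ltn_trans u_big.
have uR : 0 < u%:R :> R by rewrite ltr0n.
have codeg (S : {set H}) : S \subset U0 -> #|S| = k.-1 -> #|U :&: nonnbr S|%:R <= a1 * u%:R.
  move=> SU Sk; rewrite -ler_pdivrMr //.
  have ln : 0 < lam * n%:R by rewrite mulr_gt0.
  rewrite -(ler_pM2l ln) -ler_expR -/(w U S).
  have XS : X S by rewrite /X SU Sk eqxx.
  apply: (@le_trans _ _ (Psi U)).
    rewrite /Psi (bigD1 S) //= lerDl; apply: sumr_ge0 => S' _; exact: expR_ge0.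
  have h1 : Psi U <= Psi U * expR (kap * u%:R).
    rewrite ler_peMr ?sumr_ge0 // => [S' _|]; first exact: expR_ge0.
    by apply: le_trans _ (expR_ge1Dx _); rewrite lerDl mulr_ge0 // ltW.
  apply: (le_trans h1); apply: (le_trans hU).
  apply: (le_trans (ler_wpM2r (expR_ge0 _) Psi0)).
  rewrite -!expRD ler_expR.
  suff -> : kap * n%:R + lam * n%:R * a0 + kap * n%:R = lam * n%:R * a1 by [].
  by rewrite kapE; field.
have dvd_u : (t %| u)%N.
  have := tileable_dvd tU; rewrite cardsDS // dvdn_subr //.
have tuE : u = (t * (u %/ t))%N by rewrite mulnC divnK.
have [||T [TU cT Tt hT]] := hN0 H U (u %/ t)%N _ tuE _
    (fun v => - \sum_(S | X S) w U S * (v \in nonnbr S)%:R).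
- by rewrite leq_divRL // mulnC; move: u_big; clear; lia.
- by move=> S SU Sk; apply: codeg => //; exact: subset_trans UU0.
have cardUT : #|U :\: T| = (u - t)%N by rewrite cardsDS // Tt.
have tu : (2 * t <= u)%N by move: u_big; clear; lia.
apply: (IH (U :\: T)).
  by rewrite cardUT; move: Um tu t_gt0; clear; lia.
split.
- exact: subset_trans (subsetDl _ _) UU0.
- have -> : U0 :\: (U :\: T) = (U0 :\: U) :|: T.
    apply/setP => v; rewrite !inE; have := subsetP TU v; have := subsetP UU0 v.
    by case: (v \in U); case: (v \in T); case: (v \in U0) => // h1 h2; first [have := h1 isT|have := h2 isT].
  apply: tileableU => //; last exact: tileable_clique.
  by rewrite disjoint_sym disjoints_subset; apply/subsetP => v /(subsetP TU) vU; rewrite !inE vU.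
have sumE (A : {set H}) : A \subset U ->
    \sum_(v in A) (- \sum_(S | X S) w U S * (v \in nonnbr S)%:R) =
    - \sum_(S | X S) w U S * #|A :&: nonnbr S|%:R.
  move=> AU; rewrite sumrN exchange_big /=; congr (- _); apply: eq_bigr => S _.
  rewrite -mulr_sumr; congr (_ * _); rewrite -natr_sum; congr (_%:R).
  rewrite card_sum_mem big_mkcond; apply: eq_bigr => v _.
  by rewrite in_setI; case: (v \in A).
rewrite !sumE // mulrN lerN2 in hT.
have key : t%:R * \sum_(S | X S) expR (lam * n%:R * (#|U :&: nonnbr S|%:R / u%:R)) * (#|U :&: nonnbr S|%:R / u%:R)
    <= \sum_(S | X S) expR (lam * n%:R * (#|U :&: nonnbr S|%:R / u%:R)) * #|T :&: nonnbr S|%:R.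
  have N_gt0 : 0 < (u %/ t)%:R :> R.
    by rewrite ltr0n divn_gt0 //; move: tu; clear; lia.
  rewrite -(ler_pM2l N_gt0) mulrA -natrM mulnC -tuE.
  apply: le_trans hT; rewrite mulr_sumr.
  rewrite le_eqVlt; apply/orP; left; apply/eqP; apply: eq_bigr => S _.
  by rewrite mulrCA [u%:R * _]mulrC divfK // lt0r_neq0.
have lt_tu : (t < u)%N by move: tu t_gt0; clear; lia.
have := removal_growth lt_tu (ltW u_gt) tu u_le _ _ key => /(_ _ _)/wrap[].
- move=> S _; rewrite divr_ge0 //= ler_pdivrMr // mul1r ler_nat.
  by rewrite subset_leq_card // subsetIl.
- by move=> S _; rewrite -Tt subset_leq_card // subsetIl.
move=> step; apply: le_trans hU.
have PsiE : Psi (U :\: T) = \sum_(S | X S) expR (lam * n%:R *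
   ((u%:R * (#|U :&: nonnbr S|%:R / u%:R) - #|T :&: nonnbr S|%:R) / (u - t)%:R)).
  apply: eq_bigr => S _; rewrite /w cardUT [u%:R * _]mulrC divfK ?lt0r_neq0 //.
  have -> : #|(U :\: T) :&: nonnbr S| = (#|U :&: nonnbr S| - #|T :&: nonnbr S|)%N.
    rewrite setIDAC cardsD; congr (_ - _)%N; apply: eq_card => v.
    rewrite !inE; have := subsetP TU v; case: (v \in T); last by rewrite !andbF.
    by move=> /(_ isT) ->; rewrite andbT.
  by rewrite natrB // subset_leq_card // setSI.
rewrite PsiE cardUT natrB ?(ltnW lt_tu) //.
rewrite natrB ?(ltnW lt_tu) // in step.
apply: le_trans (ler_wpM2r (expR_ge0 _) step) _.
rewrite mulrAC -expRD (_ : kap * t%:R + kap * (u%:R - t%:R) = kap * u%:R); last by ring.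
by rewrite mulrC.
Qed.

End AlmostTiling.

(** * Absorption *)

Section Absorbers.
Local Open Scope nat_scope.
Variables (k : nat) (H : kgraph k) (t : nat).
Hypotheses (k_gt1 : 1 < k) (t_gt1 : 1 < t).
Implicit Types (s xs ys : seq H) (L F U : {set H}).

Definition absorbs L s : bool :=
  [&& uniq s, [disjoint [set v in s] & L], `[< tileable t [set v in s] >] &
      `[< tileable t ([set v in s] :|: L) >]].

Lemma set_cat s1 s2 : [set v in s1 ++ s2] = [set v in s1] :|: [set v in s2].
Proof. by apply/setP => v; rewrite !inE mem_cat. Qed.

Lemma disjoint_setsP s1 F : reflect {in s1, forall v, v \notin F} [disjoint [set v in s1] & F].
Proof.
rewrite disjoints_subset; apply: (iffP subsetP) => h v; have := h v; rewrite !inE; exact.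
Qed.

(** The pairs [(x_i, y_i)] are connected one after the other, avoiding [F] and
all earlier connections; then the union of the connections can be tiled together
with all the [x_i], or with all the [y_i]. *)
Lemma robust_connections m1 h m F xs ys :
    (forall x y : H, robust m1 h (fun s => swaps t s x y)) ->
    uniq xs -> uniq ys -> size xs = size ys ->
    {subset xs <= F} -> {subset ys <= F} -> m + #|F| + size xs * h <= m1 ->
  robust m (size xs * h) (fun s => [&& uniq s, [disjoint [set v in s] & F],
    `[< tileable t ([set v in xs] :|: [set v in s]) >] &
    `[< tileable t ([set v in ys] :|: [set v in s]) >]]).
Proof.
move=> hsw; elim: xs ys F => [|x xs IH] [|y ys] F //=.
  move=> _ _ _ _ _ _; have -> : [set v in ([::] : seq H)] = set0 by apply/setP => v; rewrite !inE.
  rewrite -setI_eq0 set0I eqxx /= !setU0; apply/andP; split; apply/asboolP; exact: tileable0.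
move=> /andP[xxs uxs] /andP[yys uys] [sxy] xF yF hm; rewrite mulSn robust_cat.
have := robust_avoid F (hsw x y); apply: robust_impl.
  by move: hm; rewrite mulSn; clear; lia.
move=> s1 s1h /andP[/and5P[us1 xs1 ys1 /asboolP tx /asboolP ty] /allP s1F].
have F1 v : v \in s1 -> v \notin F by move=> /s1F.
have cF' : #|F :|: [set v in s1]| <= #|F| + h.
  by apply: leq_trans (leq_card_setU _ _).1 _; rewrite leq_add2l cardsE -s1h card_size.
have xF' : {subset xs <= F :|: [set v in s1]}.
  by move=> v vx; rewrite inE xF // inE vx orbT.
have yF' : {subset ys <= F :|: [set v in s1]}.
  by move=> v vy; rewrite inE yF // inE vy orbT.
have hm' : m + #|F :|: [set v in s1]| + size xs * h <= m1.
  by move: hm cF'; rewrite mulSn; clear; lia.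
have := IH ys _ uxs uys sxy xF' yF' hm'; apply: robust_impl => //.
move=> s2 _ /and4P[us2 /disjoint_setsP ds2 /asboolP t1 /asboolP t2].
have dis v : v \in s2 -> (v \notin F) /\ (v \notin s1).
  by move=> /ds2; rewrite !inE negb_or => /andP[].
have tile z zs : z \notin zs -> {subset z :: zs <= F} -> tileable t (z |: [set v in s1]) ->
    tileable t ([set v in zs] :|: [set v in s2]) -> tileable t ([set v in z :: zs] :|: [set v in s1 ++ s2]).
  move=> zzs zF tz tzs.
  have -> : [set v in z :: zs] :|: [set v in s1 ++ s2] =
      (z |: [set v in s1]) :|: ([set v in zs] :|: [set v in s2]).
    by apply/setP => v; rewrite !inE mem_cat orbACA.
  apply: tileableU => //; rewrite disjoints_subset; apply/subsetP => v; rewrite !inE negb_or.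
  case/orP => [/eqP->|vs1].
    by rewrite zzs; apply/negP => /dis[]; rewrite zF ?mem_head.
  apply/andP; split; first by apply: contra (F1 v vs1) => vz; rewrite zF // inE vz orbT.
  by apply: contraL vs1 => /dis[].
apply/and4P; split.
- by rewrite cat_uniq us1 us2 andbT; apply/hasPn => v /dis[].
- by apply/disjoint_setsP => v; rewrite mem_cat => /orP[/F1|/dis[]].
- by apply/asboolP; apply: tile.
- by apply/asboolP; apply: tile.
Qed.

(** A clique [T] of order [t] outside [L] is followed by connections between the
vertices of [L] and those of [T]: without [L] they are tiled together with [T],
and otherwise they are tiled together with [L], and [T] forms a block. *)
Lemma robust_absorbs D m1 h m L :
    (forall S : {set H}, #|S| = k.-1 -> #|nonnbr S| <= D) ->
    (forall x y : H, robust m1 h (fun s => swaps t s x y)) -> #|L| = t ->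
    m + 2 * t + t * h <= m1 ->
    (forall j, j < t -> m + j + t + 'C(j, k.-1) * D <= #|H|) ->
  robust m (t + t * h) (absorbs L).
Proof.
move=> hD hsw Lt hm hV; rewrite robust_cat.
have c0 : clique [set v in ([::] : seq H)].
  by apply: clique_small; rewrite cardsE card0; apply: ltnW.
have hW j : 0 <= j < 0 + t -> m + j + 'C(j, k.-1) * D <= #|~: L|.
  rewrite add0n /= => /hV; have := cardsC L; rewrite Lt.
  by set a := 'C(_, _) * D; clear; lia.
have := @robust_clique k H D k_gt1 hD (fun=> ~: L) m t [::] isT c0 hW.
apply: robust_impl => // T Tt; rewrite cats0 => /and3P[uT cT WT].
have TL v : v \in T -> v \notin L.
  move=> vT; have := all_from_nth v (i := index v T) WT; rewrite index_mem => /(_ vT).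
  by rewrite nth_index // in_setC.
have cL : size (enum L) = t by rewrite -cardE.
have := @robust_connections m1 h m (L :|: [set v in T]) (enum L) T hsw (enum_uniq _) uT.
rewrite cL Tt => /(_ erefl) hc.
have LF : {subset enum L <= L :|: [set v in T]} by move=> v; rewrite mem_enum inE => ->.
have TF : {subset T <= L :|: [set v in T]} by move=> v vT; rewrite !inE vT orbT.
have cF : m + #|L :|: [set v in T]| + t * h <= m1.
  apply: leq_trans hm; rewrite leq_add2r leq_add2l mul2n -addnn.
  by apply: leq_trans (leq_card_setU _ _).1 _; rewrite Lt leq_add2l cardsE -Tt card_size.
have := hc LF TF cF; apply: robust_impl => //.
move=> s _ /and4P[us /disjoint_setsP ds /asboolP t1 /asboolP t2].
have E : [set v in enum L] = L by apply/setP => v; rewrite inE mem_enum.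
rewrite E in t1.
have dis v : v \in s -> (v \notin L) /\ (v \notin T).
  by move=> /ds; rewrite !inE negb_or => /andP[].
have tT : tileable t [set v in T].
  by apply: tileable_clique => //; [exact: ltnW|rewrite cardsE (card_uniqP uT)].
apply/and4P; split.
- by rewrite cat_uniq uT us andbT; apply/hasPn => v /dis[].
- by apply/disjoint_setsP => v; rewrite mem_cat => /orP[/TL|/dis[]].
- by apply/asboolP; rewrite set_cat.
- apply/asboolP; rewrite set_cat -setUA [_ :|: L]setUC; apply: tileableU => //.
  by apply/disjoint_setsP => v vT; rewrite !inE negb_or TL //; apply: contraL vT => /dis[].
Qed.

(** Distinct absorbers take in the blocks of [U] one after the other. *)
Lemma absorb_all (As : seq (seq H)) U q : uniq (flatten As) ->
    (forall s, s \in As -> tileable t [set v in s]) ->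
    [disjoint [set v in flatten As] & U] -> #|U| = t * q ->
    (forall L, L \subset U -> #|L| = t -> q <= count (absorbs L) As) ->
  tileable t ([set v in flatten As] :|: U).
Proof.
elim: q As U => [|q IH] As U uA tA dAU Uq hL.
  have /eqP -> : U == set0 by rewrite -cards_eq0 Uq muln0.
  rewrite setU0; elim: As {hL dAU} uA tA => [|s As IHA] /=.
    move=> _ _; have -> : [set v in ([::] : seq H)] = set0 by apply/setP => v; rewrite !inE.
    exact: tileable0.
  rewrite cat_uniq => /and3P[us /hasPn dsA uA] tA; rewrite set_cat; apply: tileableU.
  - by rewrite disjoint_sym; apply/disjoint_setsP => v /dsA; rewrite inE.
  - by apply: tA; rewrite mem_head.
  - by apply: IHA => // s' s'A; apply: tA; rewrite inE s'A orbT.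
have [L LU Lt] : exists2 L : {set H}, L \subset U & #|L| = t.
  exists [set v in take t (enum U)].
    by apply/subsetP => v; rewrite inE => /mem_take; rewrite mem_enum.
  have /card_uniqP := take_uniq t (enum_uniq (mem U)).
  by rewrite cardsE => ->; rewrite size_takel // -cardE Uq mulnS leq_addr.
have /hasP[s sA abs] : has (absorbs L) As by rewrite has_count (leq_ltn_trans _ (hL L LU Lt)).
set As' := rem s As; have pA : perm_eq As (s :: As') by exact: perm_to_rem.
have pf : perm_eq (flatten As) (s ++ flatten As') by exact: (perm_flatten pA).
have /and4P[us /disjoint_setsP dsL /asboolP ts /asboolP tsL] := abs.
move: uA; rewrite (perm_uniq pf) cat_uniq => /and3P[_ /hasPn dsA uA'].
have dU v : v \in flatten As -> v \notin U by apply/disjoint_setsP.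
have E : [set v in flatten As] :|: U = ([set v in s] :|: L) :|: ([set v in flatten As'] :|: U :\: L).
  apply/setP => v; rewrite !inE (perm_mem pf) mem_cat; have := subsetP LU v.
  by case: (v \in L) => [->|_]; rewrite ?orbT // ?orbF /= orbA.
rewrite E; apply: tileableU => //.
  rewrite disjoints_subset; apply/subsetP => v; rewrite !inE !negb_or negb_and negbK.
  case/orP => [vs|vL].
    apply/andP; split; first by apply: contraL vs => /dsA.
    by rewrite dU ?orbT // (perm_mem pf) mem_cat vs.
  rewrite vL /= andbT; apply: contraTN (subsetP LU _ vL) => vA.
  by apply: dU; rewrite (perm_mem pf) mem_cat vA orbT.
apply: IH => //.
- by move=> s' s'A; apply: tA; rewrite (perm_mem pA) inE s'A orbT.
- apply/disjoint_setsP => v vA; rewrite inE negb_and dU ?orbT //.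
  by rewrite (perm_mem pf) mem_cat vA orbT.
- by rewrite cardsDS // Uq Lt mulnS addKn.
- move=> L' L'U L't; have := hL L' (subset_trans L'U (subsetDl _ _)) L't.
  rewrite (permP pA) /=; have := leq_b1 (absorbs L' s); clear; lia.
Qed.

End Absorbers.

Section Selection.
Variables (R : realType) (V I : finType) (h : nat) (P : I -> pred (seq V)).
Implicit Types (s : seq V) (F : {set V}).

Lemma average_seq (w : I -> R) (Q : I -> pred (seq V)) l (B : R) :
    (forall s, size s = l -> \sum_i w i * (Q i s)%:R <= B) ->
  \sum_i w i * (count_seq l (Q i))%:R <= #|V|%:R ^+ l * B.
Proof.
elim: l Q => [|l IH] Q hQ /=; first by rewrite expr0 mul1r; exact: hQ.
rewrite (eq_bigr (fun i => \sum_v w i * (count_seq l (fun s => Q i (v :: s)))%:R)); last first.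
  by move=> i _; rewrite natr_sum mulr_sumr.
rewrite exchange_big /= exprS -mulrA mulr_natl -sumr_const.
apply: ler_sum => v _; apply: IH => s sl; apply: hQ; by rewrite /= sl.
Qed.

(** The members of [As] are chosen one after the other.  On average over all
sequences, a new member satisfies [P i] and avoids the earlier ones for a
proportion [theta] of the potential [\sum_i expR (- count (P i) As)]; a good
choice decreases the potential by the factor [expR (- (theta / 4))], because
[expR (-1) <= 1 / 2].  In the end no single [i] can have a small count. *)
Lemma select_sequences (theta : R) f r : (0 < #|V|)%N -> (0 < #|I|)%N -> 0 < theta ->
    (forall i F, (#|F| <= f)%N ->
       theta * #|V|%:R ^+ h <= (count_seq h (fun s => P i s && all [predC F] s))%:R) ->
    (forall i s, P i s -> uniq s) -> (r * h <= f)%N ->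
  exists As : seq (seq V), [/\ size (flatten As) = (r * h)%N, uniq (flatten As),
    (forall s, s \in As -> exists i, P i s) &
    \sum_i expR (- (count (P i) As)%:R) <= #|I|%:R * expR (- (theta / 4 * r%:R))].
Proof.
move=> V_gt0 I_gt0 theta_gt0 hP uP; elim: r => [_|r IH rf].
  exists [::]; split => //.
  rewrite (_ : expR (- (theta / 4 * 0%:R)) = 1) ?mulr1; last by rewrite mulr0 oppr0 expR0.
  by rewrite (eq_bigr (fun=> 1)) => [|i _]; [rewrite sumr_const|rewrite /= oppr0 expR0].
have [|As [szA uA hA potA]] := IH.
  by apply: leq_trans rf; rewrite leq_mul2r leqnSn orbT.
pose w i : R := expR (- (count (P i) As)%:R); pose Phi := \sum_i w i.
have w_gt0 i : 0 < w i by exact: expR_gt0.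
have Phi_gt0 : 0 < Phi.
  have /card_gt0P[i0 _] := I_gt0; rewrite /Phi (bigD1 i0) //= ltr_pwDl //.
  by apply: sumr_ge0 => i _; exact: ltW.
pose F := [set v in flatten As].
have F_le : (#|F| <= f)%N.
  apply: leq_trans rf; rewrite cardsE (card_uniqP uA) szA leq_mul2r leqnSn orbT //.
pose Q i s := P i s && all [predC F] s.
have [s sh hs] : exists2 s, size s = h & theta / 2 * Phi < \sum_i w i * (Q i s)%:R.
  apply: contrapT => no.
  have le_s s : size s = h -> \sum_i w i * (Q i s)%:R <= theta / 2 * Phi.
    by move=> sh; rewrite leNgt; apply/negP => hs; apply: no; exists s.
  have := average_seq le_s.
  have : theta * #|V|%:R ^+ h * Phi <= \sum_i w i * (count_seq h (Q i))%:R.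
    rewrite mulr_sumr; apply: ler_sum => i _; rewrite mulrC; apply: ler_wpM2l; first exact: ltW.
    exact: hP.
  move=> /le_trans h1 /h1; apply/negP; rewrite -ltNge.
  have Vh : 0 < #|V|%:R ^+ h :> R by rewrite exprn_gt0 // ltr0n.
  rewrite -[ltRHS]mulrA [ltRHS]mulrCA ltr_pM2l // ltr_pM2r //.
  by rewrite gtr_pMr // invf_lt1 // ltr1n.
have [i0 /andP[Pi0 /allP avoid]] : exists i, Q i s.
  apply: contrapT => no; move: hs; rewrite big1 => [|i _].
    by apply/negP; rewrite -leNgt mulr_ge0 ?(ltW Phi_gt0) // divr_ge0 // ltW.
  by case: (boolP (Q i s)) => [Qi|]; [case: no; exists i|rewrite mulr0].
exists (s :: As); split.
- by rewrite /= size_cat szA sh mulSn.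
- rewrite /= cat_uniq (uP _ _ Pi0) uA andbT /=; apply/hasPn => v vA.
  by apply/negP => /avoid; rewrite /= inE vA.
- by move=> s'; rewrite inE => /predU1P[->|/hA//]; exists i0.
- apply: (@le_trans _ _ (Phi * (1 - theta / 4))).
    apply: (@le_trans _ _ (Phi - 1 / 2 * \sum_i w i * (Q i s)%:R)); last first.
      rewrite mulrBr mulr1 lerD2l lerN2; move: hs; lra.
    rewrite mulr_sumr -sumrB; apply: ler_sum => i _ /=; rewrite natrD opprD expRD -/(w i).
    have e1 : expR (-1) <= 1 / 2 :> R.
      rewrite expRN mul1r lef_pV2 ?posrE ?expR_gt0 //.
      by apply: le_trans (expR_ge1Dx _); rewrite -natr1; lra.
    have := ler_wpM2r (ltW (w_gt0 i)) e1; have := w_gt0 i.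
    rewrite /Q; case: (P i s) => /=; last by rewrite oppr0 expR0 mulr0; lra.
    by case: (all _ _) => /=; rewrite ?mulr1 ?mulr0; lra.
  apply: (@le_trans _ _ (Phi * expR (- (theta / 4)))).
    by rewrite ler_wpM2l ?(ltW Phi_gt0) // -[- _]add0r; apply: le_trans _ (expR_ge1Dx _); rewrite add0r.
  apply: le_trans (ler_wpM2r (expR_ge0 _) potA) _.
  rewrite -[leLHS]mulrA -expRD.
  suff -> : - (theta / 4 * r%:R) + - (theta / 4) = - (theta / 4 * r.+1%:R) by [].
  by rewrite -natr1; ring.
Qed.

End Selection.

Section Absorbing.
Variables (R : realType) (k t : nat) (a alpha : R) (p q mu : nat).
Hypotheses (k_gt1 : (1 < k)%N) (t_gt1 : (1 < t)%N).
Hypotheses (a_ge0 : 0 <= a) (a_lt : a < alpha).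
Hypothesis cc : crossing_cond k t alpha p q mu.

(** [select_sequences] is applied with a number [r] of absorbers that is linear
in the number [n] of vertices; the initial potential, at most [n ^ t], is
negligible against the decrease. *)
Theorem absorbing (zeta : R) : 0 < zeta -> exists2 xi : R, 0 < xi &
  exists n0 : nat, forall (H : kgraph k), (n0 <= #|H|)%N -> small_nonnbr a H ->
  exists As : seq (seq H), [/\ uniq (flatten As),
    forall s, s \in As -> tileable t [set v in s],
    (size (flatten As))%:R <= zeta * #|H|%:R &
    forall L : {set H}, #|L| = t -> xi * #|H|%:R <= (count (absorbs t L) As)%:R].
Proof.
move=> zeta_gt0; have [K [h [n1 [K_gt0 hcon]]]] := connected k_gt1 t_gt1 a_ge0 a_lt cc.
have alpha_gt0 : 0 < alpha by exact: le_lt_trans a_lt.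
have g_gt0 : 0 < 1 - a / alpha by rewrite subr_gt0 ltr_pdivrMr // mul1r.
have [K0 K0_gt0 hK0] := divn_le_eps g_gt0; have [n2 hn2] := hK0 (2 * t)%N.
pose K2 := (2 * K + K0)%N; pose h' := (t + t * h)%N; pose Kz := (Num.bound (zeta^-1)).+1.
have t_gt0 := ltnW t_gt1.
have K2_gt0 : (0 < K2)%N by rewrite addn_gt0 K0_gt0 orbT.
have h'_gt0 : (0 < h')%N by rewrite addn_gt0 t_gt0.
pose Kr := (2 * K2 * h' * Kz)%N.
have Kr_gt0 : (0 < Kr)%N by rewrite !muln_gt0 K2_gt0 h'_gt0.
pose theta : R := (2 * (2 * K2))%:R^-1 ^+ h'.
have theta_gt0 : 0 < theta by rewrite exprn_gt0 // invr_gt0 ltr0n !muln_gt0.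
pose xi := theta / (16 * Kr%:R).
have xi_gt0 : 0 < xi by rewrite divr_gt0 ?mulr_gt0 ?ltr0n.
have [n3 hn3] := natX_le_expR t xi_gt0.
exists xi => //.
exists (maxn (maxn (maxn n1 n2) (maxn n3 t)) (maxn (K2 * (2 * t + t * h)) (maxn Kr (2 * K2)))).
move=> H; set n := #|H|.
rewrite !geq_max => /and3P[/andP[/andP[nn1 nn2] /andP[nn3 nt]] nK2 /andP[nKr nK22]] hH.
have n_gt0 : (0 < n)%N by apply: leq_trans nt.
have [D Dn hD] := small_nonnbr_nat a_ge0 hH.
pose m := (n %/ K2)%N; pose f := (n %/ (2 * K2))%N; pose r := (n %/ Kr)%N.
have rob (L : {set H}) : #|L| = t -> robust m h' (absorbs t L).
  move=> Lt; apply: (robust_absorbs k_gt1 t_gt1 hD (hcon H nn1 hH) Lt).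
    rewrite -addnA; apply: (divn_room K_gt0 _ nK2); exact: leq_addr.
  move=> j jt; apply: (@room R a alpha a_ge0 a_lt n D _ _ _ 1 Dn); rewrite ?mul1r // ?mulr1.
    exact: (bin_room t_gt1 a_ge0 a_lt cc jt).
  apply: le_trans (hn2 n nn2); rewrite ler_nat -addnA mul2n -addnn leq_add //.
    by apply: leq_div2l => //; exact: leq_addl.
  by rewrite leq_add2r ltnW.
pose I := {L : {set H} | #|L| == t}.
pose P (L : I) := absorbs t (val L).
have cI : #|{: I}| = 'C(n, t) by rewrite card_sig -card_draws; apply: eq_card => L; rewrite !inE.
have I_gt0 : (0 < #|{: I}|)%N by rewrite cI bin_gt0.
have ff : (f + f <= m)%N.
  by rewrite leq_divRL // addnn -muln2 -mulnA leq_divM.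
have many (L : I) (F : {set H}) : (#|F| <= f)%N ->
    theta * n%:R ^+ h' <= (count_seq h' (fun s => P L s && all [predC F] s))%:R.
  move=> Ff; have /robust_count := robust_avoid F (rob (val L) (eqP (valP L))).
  rewrite -(ler_nat R); apply: le_trans; rewrite natrX /theta -exprMn lerXn2r ?nnegrE //.
    by rewrite mulr_ge0 // invr_ge0.
  rewrite mulrC ler_pdivrMr ?ltr0n ?muln_gt0 // -natrM ler_nat.
  apply: (@leq_trans (2 * (2 * K2) * f)); first by rewrite leq_mul_div // muln_gt0.
  by rewrite [leqRHS]mulnC leq_mul2l; apply/orP; right; move: ff Ff; clear; lia.
have rf : (r * h' <= f)%N.
  rewrite leq_divRL ?muln_gt0 //; apply: leq_trans (leq_divM n Kr).
  rewrite -mulnA leq_mul2l /Kr; apply/orP; right.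
  by rewrite mulnC leq_pmulr.
have uP (L : I) s : P L s -> uniq s by case/and4P.
have [As [szA uA hA pot]] := select_sequences n_gt0 I_gt0 theta_gt0 many uP rf.
exists As; split => //.
- by move=> s /hA[L /and4P[_ _ /asboolP]].
- have Kz_ge : zeta^-1 <= Kz%:R.
    apply: le_trans (ltW (archi_boundP _)) _; first by rewrite invr_ge0 ltW.
    by rewrite ler_nat.
  rewrite szA mulrC -ler_pdivrMr //.
  apply: (le_trans (ler_wpM2l (ler0n _ _) Kz_ge)); rewrite -natrM ler_nat.
  apply: leq_trans (leq_divM n Kr); rewrite -mulnA leq_mul2l; apply/orP; right.
  by rewrite /Kr -!mulnA mulnA leq_pmull // muln_gt0.
- move=> L /eqP Lt; pose L' : I := exist _ L Lt.
  rewrite -[leLHS]opprK -[leRHS]opprK lerN2 -ler_expR.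
  apply: (@le_trans _ _ (\sum_(i : I) expR (- (count (P i) As)%:R))).
    by rewrite (bigD1 L') //= lerDl sumr_ge0 // => i _; exact: expR_ge0.
  apply: (le_trans pot); rewrite cI.
  apply: (@le_trans _ _ (expR (xi * n%:R) * expR (- (theta / 4 * r%:R)))).
    rewrite ler_wpM2r ?expR_ge0 //; apply: le_trans (hn3 n nn3).
    by rewrite -natrX ler_nat bin_le_exp.
  rewrite -expRD ler_expR.
  have nr : n%:R <= 2 * Kr%:R * r%:R :> R by rewrite -!natrM ler_nat leq_mul_div.
  have Kr0 : 0 < Kr%:R :> R by rewrite ltr0n.
  have := ler_wpM2l (ltW xi_gt0) nr.
  have -> : xi * (2 * Kr%:R * r%:R) = theta / 8 * r%:R.
    by rewrite /xi; field; rewrite lt0r_neq0.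
  lra.
Qed.

End Absorbing.

(** * Numerical conditions *)

Section LightCliques.
Variables (R : realType) (k t : nat) (a alpha : R).
Hypotheses (k_gt1 : (1 < k)%N) (t_gt2 : (2 < t)%N).
Hypotheses (a_ge0 : 0 <= a) (a_lt : a < alpha).

Let large_blocks : exists N0 : nat, forall N, (N0 <= N)%N -> (0 < N)%N /\ 2 <= (1 - a / alpha) * N%:R.
Proof.
have alpha_gt0 : 0 < alpha by exact: le_lt_trans a_lt.
have g_gt0 : 0 < 1 - a / alpha by rewrite subr_gt0 ltr_pdivrMr // mul1r.
exists (Num.bound (2 / (1 - a / alpha))).+1 => N hN; split; first by apply: leq_trans hN.
rewrite [leRHS]mulrC -ler_pdivrMr //; apply: le_trans (ltW (archi_boundP _)) _.
  by rewrite divr_ge0 // ltW.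
by rewrite ler_nat ltnW.
Qed.

Let block_room (C D N j : nat) : 2 <= (1 - a / alpha) * N%:R -> D%:R <= a * (t * N)%:R ->
  alpha * C%:R <= j%:R / t%:R -> (j + C * D <= j * N)%N.
Proof.
move=> hN hD hC; have t0 : 0 < t%:R :> R by rewrite ltr0n; move: t_gt2; clear; lia.
apply: (room a_ge0 a_lt hD hC).
  rewrite natrM -mulrA [X in _ * X](_ : _ = j%:R * N%:R); last by field; rewrite lt0r_neq0.
  rewrite mulrCA -[leLHS]mulr1 ler_wpM2l //; lra.
by rewrite !natrM mulrA divfK // lt0r_neq0.
Qed.

Lemma has_light_cliques_greedy :
    (forall j, (0 < j < t)%N -> alpha * 'C(j, k.-1)%:R <= j%:R / t%:R) ->
  has_light_cliques k t a.
Proof.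
move=> hC; have [N0 hN0] := large_blocks; exists N0 => H U N NN0 Ut hU c.
have [N_gt0 hN] := hN0 N NN0.
have aU : 0 <= a * #|U|%:R by rewrite mulr_ge0.
pose D := Num.truncn (a * #|U|%:R).
have hD : D%:R <= a * (t * N)%:R by rewrite -Ut truncn_le.
have codegU (S : {set H}) : S \subset U -> #|S| = k.-1 -> (#|U :&: nonnbr S| <= D)%N.
  by move=> SU Sk; rewrite truncn_ge_nat //; exact: hU.
apply: (light_clique_greedy k_gt1 codegU c Ut N_gt0 t_gt2) => [j hj|].
  apply: (block_room hN hD); apply: hC; move: hj; clear; lia.
apply: (block_room hN hD); apply: hC; move: t_gt2; clear; lia.
Qed.

Lemma has_light_cliques_exchange :
    (forall j, (0 < j < t.-1)%N -> alpha * 'C(j, k.-1)%:R <= j%:R / t%:R) ->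
    alpha * 'C(t.-1, k.-1)%:R <= 1 ->
    alpha * ('C(t - k.-1, k.-1) + 'C(t.-1, k.-2))%:R <= (t - 2)%:R / t%:R ->
  has_light_cliques k t a.
Proof.
move=> hC hA hB; have [N0 hN0] := large_blocks; exists N0 => H U N NN0 Ut hU c.
have [N_gt0 hN] := hN0 N NN0.
have aU : 0 <= a * #|U|%:R by rewrite mulr_ge0.
pose D := Num.truncn (a * #|U|%:R).
have hD : D%:R <= a * (t * N)%:R by rewrite -Ut truncn_le.
have codegU (S : {set H}) : S \subset U -> #|S| = k.-1 -> (#|U :&: nonnbr S| <= D)%N.
  by move=> SU Sk; rewrite truncn_ge_nat //; exact: hU.
apply: (light_clique_exchange k_gt1 codegU c Ut N_gt0 t_gt2) => // [j hj||].
- by apply: (block_room hN hD); exact: hC.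
- rewrite addnC; apply: (room a_ge0 a_lt hD hA); last by rewrite mul1r.
  rewrite mulr1 natrM [(t * N)%:R]natrM mulrCA mulrC ler_wpM2l //.
- apply: leq_trans (leq_addl (t - 2) _) _; exact: (block_room hN hD).
Qed.

End LightCliques.

Section Binomials.
Local Open Scope nat_scope.

Lemma bin_convex j J x : 0 < x -> j <= J -> J * 'C(j, x) <= j * 'C(J, x).
Proof.
case: x => // x _ jJ; rewrite -(leq_pmul2l (ltn0Sn x)) mulnCA -mul_bin_diag.
rewrite [leqRHS]mulnCA -mul_bin_diag mulnCA leq_mul2l leq_mul2l; apply/orP; right.
by apply/orP; right; apply: leq_bin2l; move: jJ; clear; lia.
Qed.

Lemma bin_superadd a b x : 3 < x -> 3 <= a -> 3 <= b -> 'C(a, x) + 'C(b, x) <= 'C(a + b - 3, x).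
Proof.
move=> x_gt3 a3; elim: b => // b IH b3; have [b2|b2] := eqVneq b 2.
  by rewrite b2 addnK (bin_small x_gt3) addn0.
have {}b3 : 3 <= b by move: b3 b2; clear; lia.
have := IH b3; case: x x_gt3 {IH} => // x _ h; rewrite binS addnA.
have -> : a + b.+1 - 3 = (a + b - 3).+1 by move: a3; clear; lia.
rewrite binS leq_add // leq_bin2l //; move: a3; clear; lia.
Qed.

Lemma ffact_ratio n N x : n <= N -> n ^_ x * N ^ x <= n ^ x * N ^_ x.
Proof.
move=> nN; elim: x => // x IH; rewrite !ffactnSr !expnSr.
rewrite [leqLHS]mulnACA [leqRHS]mulnACA leq_mul //.
by rewrite mulnBl mulnBr leq_sub2l // mulnC leq_mul2l nN orbT.
Qed.

Lemma bin_ratio5 n N x : 5 <= x -> 0 < N -> n <= N -> 'C(n, x) * N ^ 5 <= n ^ 5 * 'C(N, x).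
Proof.
move=> x5 N_gt0 nN.
rewrite -(leq_pmul2r (fact_gt0 x)) mulnAC bin_ffact -mulnA bin_ffact.
rewrite -(@leq_pmul2r (N ^ (x - 5))) ?expn_gt0 ?N_gt0 // -mulnA -expnD subnKC //.
apply: leq_trans (ffact_ratio x nN) _; rewrite mulnAC leq_mul2r; apply/orP; right.
rewrite -{1}(subnKC x5) expnD leq_mul2l; apply/orP; right.
by case: (posnP (x - 5)) => [->//|x5']; rewrite leq_exp2r.
Qed.

(** Writing all three binomials as multiples of ['C(t.-1, x)] turns the claim
into [0 <= x * (t ^ 2 - 3 t x + x ^ 2 + 3 x - 2)]. *)
Lemma bin_crossing t x : 0 < x -> x.+2 <= t -> 3 * t * x + 2 <= t * t + x * x + 3 * x ->
  'C(t, x) + 'C(t - 3, x) <= 2 * 'C(t.-1, x).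
Proof.
move=> x_gt0 xt; have [d ->] : exists d, t = x + d.+2 by exists (t - x.+2); move: xt; clear; lia.
move=> quad; set T := x + d.+2 in quad *.
have T1 : T.-1 = x + d.+1 by rewrite /T addnS.
have T3 : T - 3 = (x + d).-1 by rewrite /T; clear; lia.
have b1 := mul_bin_down T x; have b2 := mul_bin_down T.-1 x; have b3 := mul_bin_down (x + d) x.
rewrite T3 in b3 *; rewrite T1 in b1 b2 *.
rewrite [(x + d.+1).-1](_ : _ = x + d) in b2; last by rewrite addnS.
have E1 : T - x = d.+2 by rewrite /T addKn.
rewrite E1 in b1; rewrite !addKn in b2 b3.
set B := 'C(x + d.+1, x) in b1 b2 *; set C0 := 'C(T, x) in b1 *.
set C3 := 'C((x + d).-1, x) in b3 *; set C2 := 'C(x + d, x) in b2 b3.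
have xd : 0 < x + d by rewrite addn_gt0 x_gt0.
have pos : 0 < d.+2 * ((x + d.+1) * (x + d)) by rewrite !muln_gt0 xd addnS.
rewrite -(leq_pmul2l pos) mulnDr.
have -> : d.+2 * ((x + d.+1) * (x + d)) * C0 = (x + d.+1) * (x + d) * (T * B).
  by rewrite b1; clear; nia.
have -> : d.+2 * ((x + d.+1) * (x + d)) * C3 = d.+2 * (d.+1 * (d * B)).
  transitivity (d.+2 * ((x + d.+1) * ((x + d) * C3))); first by clear; nia.
  rewrite b3; transitivity (d.+2 * (d * ((x + d.+1) * C2))); first by clear; nia.
  by rewrite b2; clear; nia.
have h := leq_mul (leqnn (x * B)) quad.
by move: h; rewrite /T; clear; nia.
Qed.

Local Open Scope ring_scope.

(** In terms of [u = 2 / 5 - Y], the fourth degree polynomial that remains after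
dropping the term of degree [5] has only negative coefficients. *)
Lemma exchange_poly (F : realFieldType) (Y : F) : 0 < Y <= 2 / 5 ->
  (1 - 4 / 5 * Y) ^+ 5 + Y / (1 - Y) + 2 / 5 * Y <= 1.
Proof.
move=> /andP[Y0 Y1]; have Y2 : 0 < 1 - Y by lra.
have e5 : (1 - 4 / 5 * Y) ^+ 5 <= 1 - 4 * Y + 32 / 5 * Y ^+ 2 - 128 / 25 * Y ^+ 3 + 256 / 125 * Y ^+ 4.
  rewrite -subr_ge0 (_ : _ - _ = (4 / 5 * Y) ^+ 5); last by field.
  by apply: exprn_ge0; lra.
suff h : Y / (1 - Y) <= 18 / 5 * Y - 32 / 5 * Y ^+ 2 + 128 / 25 * Y ^+ 3 - 256 / 125 * Y ^+ 4 by lra.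
rewrite ler_pdivrMr //.
have u0 : 0 <= 2 / 5 - Y by lra.
have u1 := mulr_ge0 (ltW Y0) u0.
have u2 := mulr_ge0 u1 u0; have u3 := mulr_ge0 u2 u0; have u4 := mulr_ge0 u3 u0.
by lra.
Qed.

(** With [Y = x / t], dividing by [t * 'C(t.-1, x)] reduces the claim to
[exchange_poly]: the first binomial is estimated by [bin_ratio5], where
[(t - x) / (t - 1) <= 1 - 4 / 5 * Y], the second one contributes [Y / (1 - Y)],
and [2 / t <= 2 / 5 * Y]. *)
Lemma bin_exchange_far (F : realFieldType) t x : (5 <= x)%N -> (5 * x <= 2 * t)%N ->
  (t * ('C(t - x, x) + 'C(t.-1, x.-1)) <= (t - 2) * 'C(t.-1, x))%N.
Proof.
move=> x5 xt.
have t1 : (0 < t.-1)%N by move: x5 xt; clear; lia.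
have tx : (t - x <= t.-1)%N by move: x5 xt; clear; lia.
have h1 := bin_ratio5 x5 t1 tx.
have h2 : (x * 'C(t.-1, x) = (t - x) * 'C(t.-1, x.-1))%N.
  have := mul_bin_left t.-1 x.-1; rewrite prednK; last by apply: leq_trans x5.
  by move=> ->; congr (_ * _)%N; move: x5 xt; clear; lia.
set B := 'C(t.-1, x) in h1 h2 *; set E := 'C(t - x, x) in h1 *.
set C0 := 'C(t.-1, x.-1) in h2 *.
pose T : F := t%:R; pose X : F := x%:R; pose b : F := B%:R; pose e : F := E%:R; pose c : F := C0%:R.
have X5 : 5 <= X by rewrite (ler_nat _ 5 x).
have XT : 5 * X <= 2 * T by rewrite -!natrM ler_nat.
have b0 : 0 <= b by exact: ler0n.
have T1 : t.-1%:R = T - 1 by rewrite -subn1 natrB // (leq_trans t1) // leq_pred.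
have TX : (t - x)%:R = T - X by rewrite natrB //; move: xt; clear; lia.
have T2 : (t - 2)%:R = T - 2 by rewrite natrB //; move: x5 xt; clear; lia.
have {}h1 : e * (T - 1) ^+ 5 <= (T - X) ^+ 5 * b.
  by rewrite -T1 -TX -!natrX -!natrM ler_nat.
have {}h2 : X * b = (T - X) * c by rewrite -TX -!natrM h2.
rewrite -(ler_nat F) !natrM natrD T2 -/T -/b -/e -/c.
have T0 : 0 < T by lra.
pose Y := X / T; have YT : X = Y * T by rewrite divfK // lt0r_neq0.
have Y0 : 0 < Y by rewrite divr_gt0 //; lra.
have Y1 : Y <= 2 / 5 by rewrite ler_pdivrMr //; lra.
have YY := exchange_poly (introT andP (conj Y0 Y1)).
have w : T - X <= (1 - 4 / 5 * Y) * (T - 1).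
  have -> : (1 - 4 / 5 * Y) * (T - 1) = T - 4 / 5 * (Y * T) - (1 - 4 / 5 * Y) by ring.
  by rewrite -YT; lra.
have w5 : (T - X) ^+ 5 <= (1 - 4 / 5 * Y) ^+ 5 * (T - 1) ^+ 5.
  by rewrite -exprMn lerXn2r ?nnegrE //; [lra|apply: mulr_ge0; lra].
have eb : e <= (1 - 4 / 5 * Y) ^+ 5 * b.
  have pos : 0 < (T - 1) ^+ 5 by rewrite exprn_gt0 //; lra.
  rewrite -(ler_pM2r pos); apply: (le_trans h1).
  by apply: le_trans (ler_wpM2r b0 w5) _; rewrite mulrAC.
have cb : c = Y / (1 - Y) * b.
  have : T * (1 - Y) * c = T * Y * b by move: h2; rewrite YT => h2; lra.
  have Yn : 1 - Y != 0 by apply/lt0r_neq0; lra.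
  move=> h3; apply: (mulfI (lt0r_neq0 T0)); apply: (mulfI Yn).
  rewrite mulrA (mulrC _ T) h3; field; exact: Yn.
have T2b : 2 <= 2 / 5 * Y * T by rewrite -(mulrA (2 / 5)) -YT; lra.
have := ler_wpM2r b0 YY; rewrite mul1r 2!mulrDl -cb => h4.
have h5 : e + c + 2 / 5 * Y * b <= b by lra.
have h6 := ler_wpM2l (ltW T0) h5.
have h7 := ler_wpM2r b0 T2b.
by lra.
Qed.

Local Open Scope nat_scope.

(** If [2 * t < 5 * x], then the quadratic inequality leaves only the pairs
[x = 5], [t = 12] and [x = 7], [t = 17]. *)
Lemma bin_exchange t x : 5 <= x -> 3 * x <= 2 * t -> 3 * t * x + 2 <= t * t + x * x + 3 * x ->
  t * ('C(t - x, x) + 'C(t.-1, x.-1)) <= (t - 2) * 'C(t.-1, x).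
Proof.
move=> x5 xt quad; have [far|near] := leqP (5 * x) (2 * t).
  exact: (@bin_exchange_far rat).
have x12 : x < 12.
  have [d dE] : exists d, 5 * x = 2 * t + d.+1 by exists (5 * x - 2 * t).-1; move: near; clear; lia.
  move: x5 xt quad dE; clear; nia.
have t30 : t < 30 by move: near x12; clear; lia.
have /allP/(_ x) : all (fun x => all (fun t =>
    if [&& 5 <= x, 3 * x <= 2 * t, 3 * t * x + 2 <= t * t + x * x + 3 * x & 2 * t < 5 * x]
    then ((x == 5) && (t == 12)) || ((x == 7) && (t == 17)) else true) (iota 0 30)) (iota 0 12).
  by vm_compute.
rewrite mem_iota x12 => /(_ isT) /allP /(_ t); rewrite mem_iota t30 => /(_ isT).
rewrite x5 xt quad near /= => /orP[/andP[/eqP-> /eqP->]|/andP[/eqP-> /eqP->]].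
  by vm_compute.
by vm_compute.
Qed.

End Binomials.

Section Thresholds.
Variable R : realType.

Let divn_ler (c : R) (Q C : nat) (b : R) : (0 < Q)%N -> 0 <= c ->
  c * C%:R <= b * Q%:R -> c / Q%:R * C%:R <= b.
Proof.
by move=> Q0 c0 h; rewrite mulrAC ler_pdivrMr // ltr0n.
Qed.

(** At least half, rounded down, of the first [k.+1] vertices lie on each side
of the cut, and the remaining [t - k.+1] vertices do not suffice for a
[k.-1]-set on one side.  The [k.+1] vertices can be prescribed because
[4 * k <= 'C(t, k.-1)]. *)
Lemma crossing_cond_small k t : (4 <= k)%N -> (k.+1 < t)%N -> (2 * t + 3 <= 3 * k)%N ->
  crossing_cond k t (2 / 'C(t, k.-1)%:R : R) (k.+1 - k.+1./2) k.+1./2 0.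
Proof.
move=> k4 kt tk; have Q0 : (0 < 'C(t, k.-1))%N by rewrite bin_gt0; move: kt; clear; lia.
have hh := odd_double_half k.+1.
have h2 : (2 * k.+1./2 <= k.+1)%N by rewrite mul2n -{2}hh leq_addl.
have h3 : (k <= 2 * k.+1./2)%N.
    have := leq_b1 (odd k.+1); rewrite mul2n; move: hh; clear; lia.
split.
- by move: h2; clear; lia.
- by move: h2 h3 k4; clear; lia.
- by move: h2 kt; clear; lia.
- apply: divn_ler => //; rewrite mul1r -natrM ler_nat.
  have t0 : (0 < t)%N by move: kt; clear; lia.
  rewrite -(leq_pmul2l t0) mulnCA mul_bin_down mulnA leq_mul2r; apply/orP; right.
  by move: tk kt; clear; lia.
- have -> : (k.+1 - k.+1./2 + k.+1./2).-1 = k by rewrite subnK //; move: h2; clear; lia.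
  have -> : 'C(k, k.-1) = k by have := binSn k.-1; rewrite prednK //; move: k4; clear; lia.
  apply: divn_ler => //; suff : (2 * (2 * k) <= 'C(t, k.-1))%N.
    by rewrite -(ler_nat R) !natrM; lra.
  have kt' : (k.+2 <= t)%N by [].
  apply: leq_trans (leq_bin2l _ kt').
  rewrite -bin_sub; last by move: k4; clear; lia.
  have -> : (k.+2 - k.-1 = 3)%N by move: k4; clear; lia.
  rewrite -(leq_pmul2r (fact_gt0 3)) bin_ffact.
  rewrite !ffactnSr ffactn0 mul1n subn0 (_ : 3`! = 6) //.
  have -> : (k.+2 - 1 = k.+1)%N by clear; lia.
  have -> : (k.+2 - 2 = k)%N by clear; lia.
  by move: k4; clear; nia.
- move=> a b ab pa qb; rewrite !bin_small //; move: ab pa qb h2 h3 tk k4; clear; lia.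
- by rewrite addn0 divfK // pnatr_eq0 -lt0n.
Qed.

(** By convexity of the binomial coefficient in its upper entry it suffices to
consider [j = t.-1], where the condition is [2 * (t - k.-1) <= t.-1]. *)
Lemma light_small k t (a : R) : (4 <= k)%N -> (k.+1 < t)%N -> (2 * t + 3 <= 3 * k)%N ->
  0 <= a -> a < 2 / 'C(t, k.-1)%:R -> has_light_cliques k t a.
Proof.
move=> k4 kt tk a0 aa; have Q0 : (0 < 'C(t, k.-1))%N by rewrite bin_gt0; move: kt; clear; lia.
apply: (has_light_cliques_greedy _ _ a0 aa) => [||j /andP[j0 jt]]; [|move: kt k4; clear; lia|].
  by move: k4; clear; lia.
have t0 : (0 < t)%N by apply: leq_trans jt.
apply: divn_ler => //; rewrite mulrAC ler_pdivlMr ?ltr0n // -!natrM ler_nat.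
have jt' : (j <= t.-1)%N by move: jt; clear; lia.
have x0 : (0 < k.-1)%N by move: k4; clear; lia.
have h := bin_convex x0 jt'; have d := mul_bin_down t k.-1.
have t1 : (0 < t.-1)%N by apply: leq_trans jt'.
rewrite -(leq_pmul2l t1).
apply: (@leq_trans (2 * (t * (j * 'C(t.-1, k.-1))))%N).
  rewrite (_ : t.-1 * _ = 2 * t * (t.-1 * 'C(j, k.-1)))%N; last by clear; lia.
  by rewrite -mulnA leq_mul2l /= leq_mul2l h orbT.
rewrite (mulnCA t) d mulnCA [leqRHS]mulnCA leq_mul2l; apply/orP; right.
rewrite mulnA leq_mul2r; apply/orP; right; move: tk kt; clear; lia.
Qed.

Section LargeCliques.
Variables (k t : nat).
Hypotheses (k6 : (6 <= k)%N) (kt : (k.+1 < t)%N) (tk : (3 * k.-1 <= 2 * t)%N).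
Hypothesis quad : (3 * t * k.-1 + 2 <= t * t + k.-1 * k.-1 + 3 * k.-1)%N.

Let Q0 : (0 < 'C(t.-1, k.-1))%N.
Proof. by rewrite bin_gt0; move: kt; clear; lia. Qed.

(** The first five of the six prescribed vertices span at most one [k.-1]-set,
since [6 <= k]. *)
Lemma crossing_cond_large :
  crossing_cond k t (1 / 'C(t.-1, k.-1)%:R : R) 3 3 'C(t - 3, k.-1).
Proof.
split => //.
- by move: k6; clear; lia.
- by move: k6 kt; clear; lia.
- by apply: divn_ler; rewrite ?mul1r.
- apply: divn_ler => //; suff : (2 * 'C(5, k.-1) <= 'C(t.-1, k.-1))%N.
    by rewrite -(ler_nat R) natrM; lra.
  have h5 : (5 <= k.-1)%N by move: k6; clear; lia.
  apply: (@leq_trans 2).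
    have [->//|x5] := eqVneq k.-1 5.
    by rewrite bin_small //; move: h5 x5; clear; lia.
  have : (k.-1.+1 <= t.-1)%N by move: kt k6; clear; lia.
  move=> /(leq_bin2l k.-1); apply: leq_trans; rewrite binSn; move: h5; clear; lia.
- move=> a b ab a3 b3; rewrite -ab; apply: bin_superadd => //; move: k6; clear; lia.
- apply: divn_ler => //; rewrite mul1r -natrM ler_nat.
  by apply: bin_crossing => //; move: k6 kt; clear; lia.
Qed.

Lemma light_large (a : R) : 0 <= a -> a < 1 / 'C(t.-1, k.-1)%:R -> has_light_cliques k t a.
Proof.
move=> a0 aa.
have t0 : (0 < t)%N by move: kt; clear; lia.
have k1 : (1 < k)%N by move: k6; clear; lia.
have t2 : (2 < t)%N by move: kt k6; clear; lia.
have x0 : (0 < k.-1)%N by move: k6; clear; lia.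
apply: (has_light_cliques_exchange k1 t2 a0 aa) => [j /andP[j0 jt]||].
- apply: divn_ler => //; rewrite mul1r mulrAC ler_pdivlMr ?ltr0n // -!natrM ler_nat.
  have jt' : (j <= t.-2)%N by move: jt; clear; lia.
  have h := bin_convex x0 jt'; have d := mul_bin_down t.-1 k.-1.
  have pos : (0 < t.-2 * t.-1)%N by rewrite muln_gt0; move: t2; clear; lia.
  rewrite -(leq_pmul2l pos).
  apply: (@leq_trans (t * t.-1 * (j * 'C(t.-2, k.-1)))%N).
    rewrite (_ : _ * _ = t * t.-1 * (t.-2 * 'C(j, k.-1)))%N; last by clear; lia.
    by rewrite leq_mul2l h orbT.
  rewrite (_ : _ * _ = t * j * (t.-1 * 'C(t.-2, k.-1)))%N; last by clear; lia.
  rewrite d (_ : _ * _ = j * 'C(t.-1, k.-1) * (t * (t.-1 - k.-1)))%N; last by clear; lia.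
  rewrite [leqRHS]mulnC leq_mul2l; apply/orP; right.
  by move: kt k6; clear; nia.
- by apply: divn_ler; rewrite ?mul1r.
- apply: divn_ler => //; rewrite mul1r mulrAC ler_pdivlMr ?ltr0n // -!natrM ler_nat mulnC.
  by apply: bin_exchange => //; move: k6; clear; lia.
Qed.

End LargeCliques.
End Thresholds.

(** * The threshold *)

Lemma tileable_factor k (H : kgraph k) t : tileable t [set: H] -> has_factor (complete k t) H.
Proof.
move=> [P PT hP]; exists P => // B /hP[cB Bt].
pose f (i : 'I_t) : H := enum_val (cast_ord (esym Bt) i).
have f_inj : injective f by move=> i j /enum_val_inj/cast_ord_inj.
have fB i : f i \in B by exact: enum_valP.
exists f.
  split=> // e; rewrite inE => /eqP ek; have /cliqueP := cB; apply.
    by apply/subsetP => v /imsetP[i _ ->].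
  by rewrite card_imset.
apply/eqP; rewrite eqEcard card_imset // cardsT card_ord Bt leqnn andbT.
by apply/subsetP => v /imsetP[i _ ->].
Qed.

Lemma min_codeg_deg k (H : kgraph k) (S : {set H}) : #|S| = k.-1 -> (min_codeg H <= deg S)%N.
Proof.
move=> Sk; rewrite /min_codeg.
have : S \in index_enum {set H} by exact: mem_index_enum.
elim: (index_enum _) => // T r IH; rewrite inE big_cons => /predU1P[<-|/IH {}IH].
  by rewrite Sk eqxx geq_minl.
by case: ifP => // _; apply: leq_trans IH; exact: geq_minr.
Qed.

Section Factor.
Variables (R : realType) (k t : nat) (alpha : R) (p q mu : nat).
Hypotheses (k_gt1 : (1 < k)%N) (kt : (k <= t)%N).
Hypothesis cc : crossing_cond k t alpha p q mu.
Hypothesis light : forall a : R, 0 <= a -> a < alpha -> has_light_cliques k t a.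

Let t_gt1 : (1 < t)%N. Proof. exact: leq_trans kt. Qed.

Let alpha_le1 : 0 <= alpha -> alpha <= 1.
Proof.
move=> a0; apply: le_trans (cross_all cc); rewrite ler_peMr // ler1n bin_gt0.
by move: kt; clear; lia.
Qed.

(** Absorbers are set aside first.  They are so few that the other vertices keep
a proportion [a0 < alpha] of non-neighbours and have an almost perfect tiling;
the vertices that it misses are absorbed. *)
Theorem small_nonnbr_factor (a : R) : 0 <= a -> a < alpha -> exists n0 : nat,
  forall H : kgraph k, (n0 <= #|H|)%N -> (t %| #|H|)%N -> small_nonnbr a H ->
  has_factor (complete k t) H.
Proof.
move=> a_ge0 a_lt; have al1 := alpha_le1 (le_trans a_ge0 (ltW a_lt)).
pose a0 := (2 * a + alpha) / 3; pose a1 := (a + 2 * alpha) / 3; pose zeta := (a0 - a) / 2.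
have a00 : 0 <= a0 by rewrite /a0; lra.
have aa0 : a < a0 by rewrite /a0; lra.
have a01 : a0 < a1 by rewrite /a0 /a1; lra.
have a1_lt : a1 < alpha by rewrite /a1; lra.
have a1_ge0 : 0 <= a1 by lra.
have a1_le1 : a1 <= 1 by lra.
have z_gt0 : 0 < zeta by rewrite /zeta /a0; lra.
have z_le : zeta <= 1 / 2 by rewrite /zeta /a0; lra.
have [xi xi_gt0 [n1 habs]] := absorbing k_gt1 t_gt1 a_ge0 a_lt cc z_gt0.
pose eps := Num.min 1 xi.
have eps_gt0 : 0 < eps by rewrite /eps lt_min ltr01.
have eps_le1 : eps <= 1 by rewrite /eps ge_min lexx.
have [n2 halm] := almost_tiling (ltnW t_gt1) a00 a01 a1_le1 eps_gt0 eps_le1 (light a1_ge0 a1_lt).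
exists (maxn n1 (2 * n2)) => H; set n := #|H|; rewrite geq_max => /andP[nn1 nn2] tn hH.
have [As [uA tA szA cnt]] := habs H nn1 hH.
set A := [set v in flatten As].
have cA : #|A| = size (flatten As) by rewrite cardsE (card_uniqP uA).
pose U0 := ~: A.
have cU0 : #|U0|%:R = n%:R - #|A|%:R :> R.
  have -> : n = (#|A| + #|U0|)%N by rewrite cardsC.
  by rewrite natrD addrAC subrr add0r.
have A_le : #|A|%:R <= zeta * n%:R by rewrite cA.
have U0_ge : (1 - zeta) * n%:R <= #|U0|%:R by rewrite cU0 mulrBl mul1r lerB.
have U0_big : (n2 <= #|U0|)%N.
  have : n2%:R * 2 <= n%:R :> R by rewrite -natrM ler_nat mulnC.
  rewrite -(ler_nat R); have : zeta * n%:R <= 1 / 2 * n%:R by rewrite ler_wpM2r.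
  by move: U0_ge; rewrite mulrBl mul1r; lra.
have tileA : tileable t A.
  rewrite -[A]setU0; apply: (@absorb_all _ _ _ As set0 0) => //.
  - by rewrite disjoint_sym -setI_eq0 set0I.
  - by rewrite cards0 muln0.
have tU0 : (t %| #|U0|)%N.
  by have := cardsC A; rewrite -/n => E; move: tn; rewrite -/n -E dvdn_addr // (tileable_dvd tileA).
have codeg0 (S : {set H}) : S \subset U0 -> #|S| = k.-1 ->
    #|U0 :&: nonnbr S|%:R <= a0 * #|U0|%:R.
  move=> SU Sk; apply: (@le_trans _ _ (a * n%:R)).
    by apply: le_trans (hH S Sk); rewrite ler_nat subset_leq_card // subsetIr.
  apply: (@le_trans _ _ (a0 * ((1 - zeta) * n%:R))); last exact: ler_wpM2l.
  rewrite mulrA ler_wpM2r // mulrBr mulr1.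
  have : a0 * zeta <= 1 * zeta by rewrite ler_wpM2r ?(ltW z_gt0) //; lra.
  by rewrite mul1r /zeta; lra.
have [U [UU0 U_le tU]] := halm H U0 U0_big tU0 codeg0.
have tUd : (t %| #|U|)%N.
  have := tileable_dvd tU; rewrite cardsDS // dvdn_subr //.
  exact: subset_leq_card.
pose q' := (#|U| %/ t)%N.
have Uq : #|U| = (t * q')%N by rewrite mulnC divnK.
have tAU : tileable t (A :|: U).
  apply: (absorb_all uA tA _ Uq) => [|L LU Lt].
    by rewrite disjoint_sym disjoints_subset.
  rewrite -(ler_nat R); apply: le_trans (cnt L Lt).
  apply: (@le_trans _ _ #|U|%:R); first by rewrite ler_nat leq_div.
  apply: (le_trans U_le); apply: ler_pM => //; first exact: ltW.
    by rewrite ge_min lexx orbT.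
  by rewrite ler_nat max_card.
apply: tileable_factor.
have -> : [set: H] = (A :|: U) :|: (U0 :\: U).
  by apply/setP => v; rewrite !inE; case: (v \in flatten As); case: (v \in U).
apply: tileableU => //; rewrite disjoints_subset; apply/subsetP => v; rewrite !inE.
by case: (v \in flatten As); case: (v \in U).
Qed.

Theorem factor_threshold_le (gamma : R) : 0 < alpha -> 0 < gamma -> exists n0 : nat,
  forall n, (n0 <= n)%N -> (t %| n)%N ->
  (factor_threshold k n t)%:R <= (1 - alpha + gamma) * n%:R.
Proof.
move=> alpha_gt0 gamma_gt0; have al1 := alpha_le1 (ltW alpha_gt0).
pose a := Num.max (alpha - gamma / 2) 0.
have a_ge0 : 0 <= a by rewrite le_max lexx orbT.
have a_lt : a < alpha by rewrite gt_max alpha_gt0 andbT; lra.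
have [n1 hn1] := small_nonnbr_factor a_ge0 a_lt.
exists (maxn n1 (Num.bound (2 / gamma))) => n; rewrite geq_max => /andP[nn1 nn2] tn.
have ag : 0 <= 1 - alpha + gamma by lra.
have big : 2 <= gamma * n%:R.
  rewrite mulrC -ler_pdivrMr //; apply: le_trans (ltW (archi_boundP _)) _.
    by rewrite divr_ge0 // ltW.
  by rewrite ler_nat.
pose d := Num.truncn ((1 - alpha + gamma) * n%:R).
have bn_ge0 : 0 <= (1 - alpha + gamma) * n%:R by rewrite mulr_ge0.
have /andP[d_le d_gt] := truncn_itv bn_ge0.
apply: le_trans d_le; rewrite ler_nat /factor_threshold; case: ex_minnP => m _; apply.
apply/asboolP => H Hn dH; apply: hn1; rewrite -/(Defs.order H) ?Hn // => S Sk.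
have deg_le := leq_trans dH (min_codeg_deg Sk).
have : (#|nonnbr S| + deg S <= n)%N.
  have dis : [disjoint nonnbr S & [set v | v |: S \in edges H]].
    by rewrite disjoints_subset; apply/subsetP => v; rewrite !inE => /andP[].
  rewrite -Hn /Defs.order /deg; move: dis; rewrite -leq_card_setU => /eqP <-.
  exact: max_card.
rewrite -(ler_nat R) natrD => h.
have d_deg : d%:R <= (deg S)%:R :> R by rewrite ler_nat.
have aa : (alpha - gamma / 2) * n%:R <= a * n%:R by rewrite ler_wpM2r // le_max lexx.
have -> : #|H| = n by [].
move: d_gt; rewrite -natr1; lra.
Qed.
End Factor.

Theorem corollary1p5 (R : realType) (k t : nat) (gamma : R)
    (k_ge4 : (4 <= k)%N) (k_lt_t1 : (k < t - 1)%N) (gamma_gt0 : 0 < gamma) :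
  exists n0 : nat, forall n : nat, (n0 <= n)%N -> (t %| n)%N ->
    ((5 <= k + 1)%N -> (k + 1 < t)%N -> t%:R < 3 * k%:R / 2 - 1 :> R ->
       (factor_threshold k n t)%:R
         <= (1 - 2 * ('C(t, k - 1)%:R)^-1 + gamma) * n%:R :> R)
    /\
    ((6 <= k)%N ->
     3 * (k%:R - 1) + Num.sqrt (5 * k%:R ^+ 2 - 22 * k%:R + 25)
       <= 2 * t%:R :> R ->
       (factor_threshold k n t)%:R
         <= (1 - ('C(t - 1, k - 1)%:R)^-1 + gamma) * n%:R :> R).
Proof.
have kt : (k.+1 < t)%N by move: k_lt_t1; clear; lia.
have k1 : (1 < k)%N by apply: leq_trans k_ge4.
have kt' : (k <= t)%N by apply: ltnW (ltnW kt).
pose cond1 := t%:R < 3 * k%:R / 2 - 1 :> R.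
pose cond2 := (6 <= k)%N && (3 * (k%:R - 1) + Num.sqrt (5 * k%:R ^+ 2 - 22 * k%:R + 25) <= 2 * t%:R :> R).
have [n1 h1] : exists n1, cond1 -> forall n, (n1 <= n)%N -> (t %| n)%N ->
    (factor_threshold k n t)%:R <= (1 - 2 / 'C(t, k.-1)%:R + gamma) * n%:R :> R.
  have [c1|] := boolP cond1; last by exists 0%N.
  have tk : (2 * t + 3 <= 3 * k)%N.
    suff : (2 * t + 2 < 3 * k)%N by clear; lia.
    by rewrite -(ltr_nat R) natrD !natrM; move: c1; rewrite /cond1; lra.
  have C_gt0 : 0 < 2 / 'C(t, k.-1)%:R :> R.
    by rewrite divr_gt0 // ltr0n bin_gt0; move: kt; clear; lia.
  have [n1 h1] := factor_threshold_le k1 kt' (crossing_cond_small R k_ge4 kt tk)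
    (fun a => light_small k_ge4 kt tk) C_gt0 gamma_gt0.
  by exists n1.
have [n2 h2] : exists n2, cond2 -> forall n, (n2 <= n)%N -> (t %| n)%N ->
    (factor_threshold k n t)%:R <= (1 - 1 / 'C(t.-1, k.-1)%:R + gamma) * n%:R :> R.
  have [/andP[k6 c2]|] := boolP cond2; last by exists 0%N.
  set s := Num.sqrt _ in c2; have s_ge0 : 0 <= s by exact: sqrtr_ge0.
  have k6R : 6 <= k%:R :> R by rewrite (ler_nat _ 6).
  have x1 : k.-1%:R = k%:R - 1 :> R by rewrite -subn1 natrB // ltnW.
  have tk : (3 * k.-1 <= 2 * t)%N by rewrite -(ler_nat R) !natrM x1; lra.
  have s2 : s ^+ 2 = 5 * k%:R ^+ 2 - 22 * k%:R + 25 by rewrite sqr_sqrtr //; nra.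
  have quad : (3 * t * k.-1 + 2 <= t * t + k.-1 * k.-1 + 3 * k.-1)%N.
    rewrite -(ler_nat R) !natrD !natrM x1.
    have : s ^+ 2 <= (2 * t%:R - 3 * (k%:R - 1)) ^+ 2.
      by rewrite lerXn2r ?nnegrE //; lra.
    by rewrite s2; lra.
  have C_gt0 : 0 < 1 / 'C(t.-1, k.-1)%:R :> R.
    by rewrite divr_gt0 // ltr0n bin_gt0; move: kt; clear; lia.
  have [n2 h2] := factor_threshold_le k1 kt' (crossing_cond_large R k6 kt quad)
    (@light_large R k t k6 kt tk quad) C_gt0 gamma_gt0.
  by exists n2.
exists (maxn n1 n2) => n; rewrite geq_max => /andP[nn1 nn2] tn; split.
  by move=> _ _ c1; rewrite subn1; exact: h1.
move=> k6 c2; rewrite !subn1 -[X in 1 - X]mul1r; apply: h2 => //.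
by rewrite /cond2 k6.
Qed.
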